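(* Let $k\ge2$ and let $(\mathscr V,\mathbf c,\boldsymbol\mu)$ be an entropy system with $\mathscr V=(V_0,\dots,V_r)$, such that $1=c_1>c_2>\cdots>c_{r+1}=c>0$, $\mathrm{supp}(\mu_j)=V_j\cap\{0,1\}^k$ for $1\le j\le r$, and, for some $\varepsilon>0$, $\mathrm e(\mathscr V',\mathbf c,\boldsymbol\mu)\ge\mathrm e(\mathscr V,\mathbf c,\boldsymbol\mu)+\varepsilon$ for every proper subflag $\mathscr V'<\mathscr V$. Put $d=\dim V_r-1$, let $\mathbf 1,\omega^1,\dots,\omega^d$ be a basis of $V_r$ over $\mathbb Q$ consisting of points of $\{0,1\}^k$ with $V_j=\mathrm{Span}_{\mathbb Q}\{\mathbf 1,\omega^1,\dots,\omega^{\dim V_j-1}\}$ for $0\le j\le r$, and put $\Gamma=\mathbb Z\mathbf 1+\sum_{t=1}^d\mathbb Z\omega^t$. There is a constant $\kappa_0>0$, depending on the system, with $2\kappa_0<\min_{1\le j\le r}(c_j-c_{j+1})$, such that for every fixed $0<\kappa\le\kappa_0$ the following holds. There are constants $C_0,\alpha>0$ such that, for every $0<\delta<1$ and all sufficiently large $D$, one has $$\mathbb P\left(|\mathscr L_i(\mathcal A)|\ge C_0\,\delta^\alpha D^{(1-\kappa/i)\sum_{j=1}^rc_j\dim(V_j/V_{j-1})}\right)\ge1-\delta$$ for every integer $i\ge1$. The constants $C_0,\alpha$ and the lower bound on $D$ are independent of $i$ (and $C_0,\alpha$ are independent of $\delta$ and $D$).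
   Context: Vector spaces are over $\mathbb Q$; $\mathbf 1=(1,\dots,1)\in\mathbb Q^k$; logarithms are natural and $0\log0=0$. $U<V$ denotes a proper subspace. An entropy system is a triple $(\mathscr V,\mathbf c,\boldsymbol\mu)$ with $\mathscr V=(V_0,\dots,V_r)$, $\mathbf c=(c_1,\dots,c_{r+1})$, $\boldsymbol\mu=(\mu_1,\dots,\mu_r)$ such that: (a) $\langle\mathbf 1\rangle=V_0<V_1<\cdots<V_r\le\mathbb Q^k$ and each $V_j$ is spanned by points of $\{0,1\}^k$; (b) $V_r$ is non-degenerate: for all $1\le s<t\le k$ there is $x\in V_r$ with $x_s\ne x_t$; (c) $1\ge c_1\ge\cdots\ge c_{r+1}\ge0$; (d) each $\mu_j$ is a probability measure on $V_j\cap\{0,1\}^k$ (extended by zero). For a finitely supported probability measure $\mu$ and $W\le\mathbb Q^k$: $\mathbb H_\mu(W)=-\sum_x\mu(x)\log\mu(W+x)$, where $\mu(W+x)=\sum_{y\in W+x}\mu(y)$. A subflag $\mathscr V'\le\mathscr V$ is a sequence $\langle\mathbf 1\rangle=V_0'\le\cdots\le V_r'$ of subspaces with $V_j'\le V_j$ for all $j$; it is proper ($\mathscr V'<\mathscr V$) if $V_j'<V_j$ for some $1\le j\le r$. Put $\mathrm e(\mathscr V',\mathbf c,\boldsymbol\mu)=\sum_{j=1}^r(c_j-c_{j+1})\mathbb H_{\mu_j}(V_j')+\sum_{j=1}^rc_j\dim(V_j'/V_{j-1}')$. $\mathcal A\subseteq\mathbb N=\{1,2,\dots\}$ is the random set whose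 membership events $m\in\mathcal A$ are mutually independent with $\mathbb P(m\in\mathcal A)=1/m$. For $i\ge1$ put $I_i(D)=\bigcup_{j=1}^r(D^{c_{j+1}},D^{c_j(1-\kappa/i)}]$. A map $\psi:\mathcal A\cap I_i(D)\to\{0,1\}^k$ is compatible if $\psi(a)\in V_j$ whenever $a\in(D^{c_{j+1}},D^{c_j(1-\kappa/i)}]$. It is non-degenerate if for every $s\ne t$ there is $a$ in its domain with $\psi(a)_s\ne\psi(a)_t$. $\mathscr L_i(\mathcal A)$ is the set of classes modulo $\langle\mathbf 1\rangle$ of the vectors $\sum_{a\in\mathcal A\cap I_i(D)}a\,\psi(a)$, where $\psi$ ranges over the non-degenerate compatible maps for which this vector lies in $\Gamma$. *)

(* Defs.v *)
From HB Require Import structures.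
From mathcomp Require Import all_boot all_order all_algebra.
From mathcomp Require Import finmap.
From mathcomp Require Import all_classical all_reals all_analysis.

Set Implicit Arguments.
Unset Strict Implicit.
Unset Printing Implicit Defensive.

Import Order.TTheory GRing.Theory Num.Theory.
Import numFieldNormedType.Exports.

Local Open Scope classical_set_scope.
Local Open Scope ring_scope.

(* Flags, exponents and measures are indexed by all of nat; for a flag of
   length r only V_0, ..., V_r, c_1, ..., c_(r+1) and mu_1, ..., mu_r are
   constrained or used. *)

Definition onev (k : nat) : 'rV[rat]_k := const_mx 1.

Definition cube (k : nat) : set 'rV[rat]_k :=
  [set x | forall s : 'I_k, x ord0 s = 0 \/ x ord0 s = 1].

Definition vcoset (k : nat) (W : {vspace 'rV[rat]_k}) (x : 'rV[rat]_k) :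
    set 'rV[rat]_k :=
  [set y | y - x \in W].

Record is_prob_on (R : realType) (k : nat) (S : set 'rV[rat]_k)
    (mu : 'rV[rat]_k -> R) : Prop := IsProbOn {
  prob_on_ge0 : forall x, 0 <= mu x ;
  prob_on_supp : forall x, mu x != 0 -> S x ;
  prob_on_sum : \sum_(x \in [set: 'rV[rat]_k]) mu x = 1
}.

(* The sums range over the finite support of the summand; mathcomp-analysis
   sets ln 0 = 0, which agrees with the convention 0 log 0 = 0. *)
Definition entropyH (R : realType) (k : nat) (mu : 'rV[rat]_k -> R)
    (W : {vspace 'rV[rat]_k}) : R :=
  - \sum_(x \in [set: 'rV[rat]_k])
      mu x * ln (\sum_(y \in vcoset W x) mu y).

Record entropy_system (R : realType) (k r : nat)
    (V : nat -> {vspace 'rV[rat]_k}) (c : nat -> R)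
    (mu : nat -> 'rV[rat]_k -> R) : Prop := EntropySystem {
  es_V0 : V 0%N = <[onev k]>%VS ;
  es_V_lt : forall j, (j < r)%N -> (V j <= V j.+1)%VS /\ V j <> V j.+1 ;
  es_V_span : forall j, (j <= r)%N ->
    exists s : seq 'rV[rat]_k, {in s, forall x, cube x} /\ V j = << s >>%VS ;
  es_nondeg : forall s t : 'I_k, (s < t)%N ->
    exists2 x, x \in V r & x ord0 s <> x ord0 t ;
  es_c_le1 : c 1%N <= 1 ;
  es_c_noninc : forall j, (1 <= j <= r)%N -> c j.+1 <= c j ;
  es_c_ge0 : 0 <= c r.+1 ;
  es_mu : forall j, (1 <= j <= r)%N ->
    is_prob_on ([set x | x \in V j] `&` @cube k) (mu j)
}.

Record subflag (k r : nat) (V' V : nat -> {vspace 'rV[rat]_k}) : Prop :=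
  Subflag {
  subflag_0 : V' 0%N = <[onev k]>%VS ;
  subflag_mono : forall j, (j < r)%N -> (V' j <= V' j.+1)%VS ;
  subflag_le : forall j, (j <= r)%N -> (V' j <= V j)%VS
}.

Definition proper_subflag (k r : nat) (V' V : nat -> {vspace 'rV[rat]_k}) :
    Prop :=
  subflag r V' V /\ exists2 j, (1 <= j <= r)%N & V' j <> V j.

(* dim (V_j / V_(j-1)); the truncated subtraction is harmless because V is
   only used as a nondecreasing flag. *)
Definition dimq (k : nat) (V : nat -> {vspace 'rV[rat]_k}) (j : nat) : nat :=
  (\dim (V j) - \dim (V j.-1))%N.

Definition entropy_e (R : realType) (k r : nat)
    (V : nat -> {vspace 'rV[rat]_k}) (c : nat -> R)
    (mu : nat -> 'rV[rat]_k -> R) : R :=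
  \sum_(1 <= j < r.+1) (c j - c j.+1) * entropyH (mu j) (V j)
  + \sum_(1 <= j < r.+1) c j * (dimq V j)%:R.

Definition one_omega (k : nat) (omega : nat -> 'rV[rat]_k) (n : nat) :
    seq 'rV[rat]_k :=
  onev k :: [seq omega t | t <- iota 1 n].

Definition Gamma (k : nat) (omega : nat -> 'rV[rat]_k) (d : nat) :
    set 'rV[rat]_k :=
  [set x | inIntSpan (in_tuple (one_omega omega d)) x].

Record log_random_set (R : realType) (dT : measure_display)
    (T : measurableType dT) (P : probability T R) (A : T -> set nat) : Prop :=
  LogRandomSet {
  lrs_pos : forall w m, A w m -> (0 < m)%N ;
  lrs_meas : forall m, (0 < m)%N -> measurable [set w | A w m] ;
  lrs_prob : forall m, (0 < m)%N -> P [set w | A w m] = (m%:R^-1)%:E ;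
  lrs_indep : forall S : {fset nat}, (forall m, m \in S -> (0 < m)%N) ->
    P (\bigcap_(m in [set` S]) [set w | A w m])
    = (\prod_(m <- S) P [set w | A w m])%E
}.

Definition Iblock (R : realType) (c : nat -> R) (kappa D : R) (i j : nat) :
    set nat :=
  [set a | D `^ (c j.+1) < a%:R <= D `^ (c j * (1 - kappa / i%:R))].

Definition Iset (R : realType) (r : nat) (c : nat -> R) (kappa D : R)
    (i : nat) : set nat :=
  \bigcup_(j in [set j | (1 <= j <= r)%N]) Iblock c kappa D i j.

(* psi is a total function on nat, but only its restriction to the finite set
   A `&` Iset r c kappa D i is ever constrained or used. *)
Definition compatible (R : realType) (k r : nat)
    (V : nat -> {vspace 'rV[rat]_k}) (c : nat -> R) (kappa D : R) (i : nat)
    (A : set nat) (psi : nat -> 'rV[rat]_k) : Prop :=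
  (forall a, (A `&` Iset r c kappa D i) a -> cube (psi a)) /\
  (forall j a, (1 <= j <= r)%N -> A a -> Iblock c kappa D i j a ->
     psi a \in V j).

Definition nondegenerate (k : nat) (dom : set nat) (psi : nat -> 'rV[rat]_k) :
    Prop :=
  forall s t : 'I_k, s <> t ->
    exists2 a, dom a & psi a ord0 s <> psi a ord0 t.

Definition psi_sum (k : nat) (dom : set nat) (psi : nat -> 'rV[rat]_k) :
    'rV[rat]_k :=
  \sum_(a \in dom) a%:R *: psi a.

(* A class modulo <1> is represented by the coset it is. *)
Definition Lset (R : realType) (k r : nat) (V : nat -> {vspace 'rV[rat]_k})
    (c : nat -> R) (G : set 'rV[rat]_k) (kappa D : R) (i : nat)
    (A : set nat) : set (set 'rV[rat]_k) :=
  [set vcoset <[onev k]>%VS (psi_sum (A `&` Iset r c kappa D i) psi)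
     | psi in [set psi |
         [/\ compatible r V c kappa D i A psi,
             nondegenerate (A `&` Iset r c kappa D i) psi &
             G (psi_sum (A `&` Iset r c kappa D i) psi)]]].

Definition card_set (U : choiceType) (X : set U) : nat := #|` fset_set X|%fset.

(* Main.v *)
Require Import Defs.
From mathcomp Require Import all_boot all_order all_algebra.
From mathcomp Require Import finmap.
From mathcomp Require Import all_classical all_reals all_analysis.
From mathcomp Require Import ring lra zify.
Import Order.TTheory GRing.Theory Num.Theory.
Import numFieldNormedType.Exports.
Local Open Scope classical_set_scope.
Local Open Scope ring_scope.
Set Implicit Arguments.
Unset Strict Implicit.
Unset Printing Implicit Defensive.

(** The number of classes is bounded below by a moment method with a small
    exponent [q > 0].  Attach to the elements [b] of a finite set [B] independent
    random points [psi b], distributed according to [mu j] when [b] lies in the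
    [j]th block, and let [S] be the sum of the [b psi b].  For a subspace [W] let
    [cosetP W B z] be the probability that [S] lies in [z + W], and let
    [moment W B s] be the mean of [cosetP W B (S + s) ^ q].  If the moment for
    [W = <1>] and [s = 0] is at most [N], then by Markov's inequality [S] lies
    in a class of mass at most [tau] outside an event of probability
    [tau^-q N]; so paths [psi] of total mass [m] reach at least
    [(m - tau^-q N) / tau] classes (lemma [good_mass_le_card]).  With [N] of size
    [D^-(q E) / delta], [E] being the exponent to be reached, a suitable [tau]
    gives [delta^(1/q) D^E] classes.

    The moment averaged over the random set, [meanM n W s] for the elements up
    to [n], obeys a recursion in [n].  When a new element [b] is added, a second
    path either agrees with the first one at [b] modulo [W], which costs the
    factor [coset_power], about [1 - q H(W)], or it differs from it there by
    [v = x - x'] outside [W], which shifts the argument by [b v].  Such shifts by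
    distinct multiples of [v] are disjoint modulo [W] and all lie in one coset
    of [W + <v>]; by concavity of the [q]th power, summing them over [b] between
    [n] and [4 n] with the weights [1 / b] costs only [n^-q] and turns [W] into
    [W + <v>] (lemma [block_bound]).  Unrolled from the largest elements down,
    the recursion makes [W] run through a flag starting at [<1>], with a cost
    that is linear in the logarithms of the scales where [W] jumps.  It is thus
    least when all jumps occur at the ends of blocks, where it becomes the
    entropy [e] of a subflag ([tail_cost_slope], [total_cost_lower]).  Every
    proper subflag exceeds the full flag by [eps], and part of this excess is
    spent as a constant gain at each doubling of the scale: so the sum over the
    jump scales is a geometric series and no power of [ln D] is lost
    ([M_in_block]).

    The required paths must be non-degenerate and must have their sum in [Gamma].
    For large [D] the last block contains, with probability at least
    [1 - delta / 2], a prescribed number of elements congruent to [1] modulo a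
    common denominator [Q] ([sublistE_half_count], [progression_sum]).  Changing
    any path on those few elements only can make it take every point of the cube
    in [V_r] and correct its sum modulo [Gamma] ([correct_residues]).  Hence the
    good paths have a mass bounded below independently of [delta] and [D]
    ([pathE_lower]). *)

(** * Powers with exponent between 0 and 1 *)

Section PowerSums.
Variables (R : realType) (q : R).
Hypothesis q01 : 0 < q < 1.

Lemma powR_subadd (a b : R) : 0 <= a -> 0 <= b ->
  (a + b) `^ q <= a `^ q + b `^ q.
Proof.
move=> a0 b0; have /andP[q0 q1] := q01.
have [s0|s_neq0] := eqVneq (a + b) 0.
  by rewrite s0 powR0 ?gt_eqF// addr_ge0 ?powR_ge0.
have s_gt0 : 0 < a + b by rewrite lt_def s_neq0 addr_ge0.
have aux c : 0 <= c -> c <= a + b -> c / (a + b) * (a + b) `^ q <= c `^ q.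
  move=> c0 cs; have [->|cn0] := eqVneq c 0.
    by rewrite !mul0r powR_ge0.
  have cp : 0 < c by rewrite lt_def cn0.
  rewrite -[in leRHS](divfK s_neq0 c) powRM ?divr_ge0 ?(ltW s_gt0)//.
  rewrite ler_wpM2r ?powR_ge0//.
  apply: ger1_powR; last exact: ltW.
  by rewrite divr_gt0//= ler_pdivrMr// mul1r.
rewrite -[leLHS]mul1r -(divff s_neq0) [X in X * _]mulrDl mulrDl.
by rewrite lerD// aux// ?lerDl ?lerDr.
Qed.

Lemma powR_sum_le (I : Type) (s : seq I) (P : pred I) (f : I -> R) :
  (forall i, 0 <= f i) ->
  (\sum_(i <- s | P i) f i) `^ q <= \sum_(i <- s | P i) (f i) `^ q.
Proof.
move=> f0; have /andP[q0 q1] := q01; elim: s => [|i s IH].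
  by rewrite !big_nil powR0 ?gt_eqF.
rewrite !big_cons; case: ifP => // _.
by rewrite (le_trans (powR_subadd _ _)) ?sumr_ge0 ?lerD2l.
Qed.

(** The graph of a concave function lies below its tangent at [1]. *)
Lemma powR_tangent (y : R) : 0 <= y -> y `^ q <= 1 - q + q * y.
Proof.
move=> y0; have /andP[q0 q1] := q01; have q1' : 0 < 1 - q by rewrite subr_gt0.
have := @conjugate_powR R (y `^ q) 1 q^-1 (1 - q)^-1 (powR_ge0 _ _) ler01.
rewrite !invr_gt0 q0 q1' => /(_ isT isT).
rewrite !invrK => /(_ (subrKC _ _)).
rewrite -powRrM mulfV ?gt_eqF// powRr1// powR1 mulr1 mul1r; lra.
Qed.

(** Jensen for the concave power [q]: bound each term by the tangent at the mean. *)
Lemma sum_powR_le (I : eqType) (s : seq I) (f : I -> R) :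
  (forall i, 0 <= f i) ->
  \sum_(i <- s) (f i) `^ q
    <= (size s)%:R `^ (1 - q) * (\sum_(i <- s) f i) `^ q.
Proof.
move=> f0; have /andP[q0 q1] := q01.
have [S0|Sn0] := eqVneq (\sum_(i <- s) f i) 0.
  rewrite S0 powR0 ?gt_eqF// mulr0 big_seq big1// => i si.
  have : f i <= 0.
    by rewrite -S0 (big_rem i)//= lerDl sumr_ge0.
  by move=> fi; rewrite (@le_anti _ _ (f i) 0) ?fi ?f0// powR0 ?gt_eqF.
set S := \sum_(i <- s) f i in Sn0 *.
have S_gt0 : 0 < S by rewrite lt_def Sn0 sumr_ge0.
have n_gt0 : 0 < (size s)%:R :> R.
  by rewrite ltr0n lt0n size_eq0; apply: contraNneq Sn0 => s0; rewrite /S s0 big_nil.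
set n := (size s)%:R in n_gt0 *.
have l_gt0 : 0 < S / n by rewrite divr_gt0.
have -> : n `^ (1 - q) * S `^ q = n * (S / n) `^ q.
  rewrite powRM ?ltW ?invr_gt0// mulrCA mulrC; congr (_ * _).
  rewrite powRB ?(gt_eqF n_gt0) ?implybT//.
  rewrite powRr1 ?ltW// -(powR_inv1 (ltW n_gt0)).
  by rewrite -powRrM mulN1r powRN.
apply: (@le_trans _ _ (\sum_(i <- s) (S / n) `^ q * (1 - q + q * (f i / (S / n))))).
  apply: ler_sum => i _.
  have fi0 : 0 <= f i / (S / n) by rewrite divr_ge0// ltW.
  rewrite -[in leLHS](divfK (lt0r_neq0 l_gt0) (f i)).
  rewrite (powRM _ fi0 (ltW l_gt0)).
  by rewrite [leLHS]mulrC ler_wpM2l ?powR_ge0// powR_tangent.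
rewrite -mulr_sumr mulrC ler_wpM2r ?powR_ge0// big_split/= -mulr_sumr -mulr_suml.
rewrite big_const_seq count_predT iter_addr_0 -/S -mulr_natr -/n.
rewrite le_eqVlt; apply/orP; left; apply/eqP; field.
by rewrite ?gt_eqF.
Qed.

End PowerSums.

(** * Expectations over random sublists *)

Section RandomSublists.
Variable R : realType.

(** The expectation of [G] over a random sublist of [s] that keeps each [b]
    independently with probability [1 / b]. *)
Fixpoint sublistE (s : seq nat) (G : seq nat -> R) : R :=
  if s is b :: s' then
    (1 - b%:R^-1) * sublistE s' G + b%:R^-1 * sublistE s' (fun B => G (b :: B))
  else G [::].

Lemma invn_itv (b : nat) : (0 < b)%N -> 0 <= (b%:R^-1 : R) <= 1.
Proof. by move=> b0; rewrite invr_ge0 ler0n/= invf_le1 ?ltr0n ?ler1n. Qed.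

Lemma sublistE_le (s : seq nat) (G G' : seq nat -> R) :
  (forall b, b \in s -> (0 < b)%N) ->
  (forall B, subseq B s -> G B <= G' B) -> sublistE s G <= sublistE s G'.
Proof.
elim: s G G' => [|b s IH] G G' s0 GG' /=; first exact: GG'.
have /andP[b0 b1] := invn_itv (s0 b (mem_head _ _)).
have s0' x : x \in s -> (0 < x)%N by move=> xs; apply: s0; rewrite inE xs orbT.
apply: lerD; rewrite ler_wpM2l ?subr_ge0// IH// => B sB; apply: GG'.
  exact: subseq_trans sB (subseq_cons _ _).
by rewrite /= eqxx.
Qed.

Lemma sublistEZ (s : seq nat) (a : R) (G : seq nat -> R) :
  sublistE s (fun B => a * G B) = a * sublistE s G.
Proof. by elim: s G => [//|b s IH] G /=; rewrite !IH; ring. Qed.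

Lemma sublistED (s : seq nat) (G G' : seq nat -> R) :
  sublistE s (fun B => G B + G' B) = sublistE s G + sublistE s G'.
Proof. by elim: s G G' => [//|b s IH] G G' /=; rewrite !IH; ring. Qed.

Lemma sublistE_cst (s : seq nat) (a : R) : sublistE s (fun=> a) = a.
Proof. by elim: s => [//|b s IH] /=; rewrite !IH; ring. Qed.

Lemma sublistE_sum (s : seq nat) (I : Type) (t : seq I) (P : pred I)
    (G : I -> seq nat -> R) :
  sublistE s (fun B => \sum_(i <- t | P i) G i B)
  = \sum_(i <- t | P i) sublistE s (G i).
Proof.
elim: t => [|i t IH].
  by rewrite big_nil -[RHS](sublistE_cst s); congr sublistE; apply/funext => B; rewrite big_nil.
rewrite big_cons -IH; case: ifP => Pi.
  by rewrite -sublistED; congr sublistE; apply/funext => B; rewrite big_cons Pi.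
by congr sublistE; apply/funext => B; rewrite big_cons Pi.
Qed.

End RandomSublists.

(** * Random sums and the moments of their coset masses *)

Section Walk.
Variables (R : realType) (k : nat) (Xs : seq 'rV[rat]_k).
Variable nu : nat -> 'rV[rat]_k -> R.
Hypothesis nu_ge0 : forall b x, 0 <= nu b x.
Hypothesis nu_sum : forall b, \sum_(x <- Xs) nu b x = 1.
Implicit Types (B : seq nat) (g : 'rV[rat]_k -> R) (W : {vspace 'rV[rat]_k}).

(** The expectation of [g (sum of b x_b over B)], where the [x_b] are independent
    with law [nu b] on [Xs]. *)
Fixpoint walkE B g : R :=
  if B is b :: B' then
    \sum_(x <- Xs) nu b x * walkE B' (fun y => g (b%:R *: x + y))
  else g 0.

Lemma walkE_le B g g' : (forall y, g y <= g' y) -> walkE B g <= walkE B g'.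
Proof.
elim: B g g' => [|b B IH] g g' gg' /=; first exact: gg'.
by apply: ler_sum => x _; rewrite ler_wpM2l// IH.
Qed.

Lemma walkEZ B (a : R) g : walkE B (fun y => a * g y) = a * walkE B g.
Proof.
elim: B g => [//|b B IH] g /=; rewrite mulr_sumr; apply: eq_bigr => x _.
by rewrite IH; ring.
Qed.

Lemma walkED B g g' : walkE B (fun y => g y + g' y) = walkE B g + walkE B g'.
Proof.
elim: B g g' => [//|b B IH] g g' /=; rewrite -big_split/=; apply: eq_bigr => x _.
by rewrite IH mulrDr.
Qed.

Lemma walkE_cst B (a : R) : walkE B (fun=> a) = a.
Proof.
elim: B => [//|b B IH] /=; under eq_bigr do rewrite IH.
by rewrite -mulr_suml nu_sum mul1r.
Qed.

Lemma walkE_ge0 B g : (forall y, 0 <= g y) -> 0 <= walkE B g.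
Proof. by move=> g0; rewrite -(walkE_cst B 0) walkE_le. Qed.

Lemma walkE_sum B (I : Type) (t : seq I) (P : pred I) (g : I -> 'rV[rat]_k -> R) :
  walkE B (fun y => \sum_(i <- t | P i) g i y)
  = \sum_(i <- t | P i) walkE B (g i).
Proof.
elim: t => [|i t IH].
  by rewrite big_nil -[RHS](walkE_cst B); congr walkE; apply/funext => y; rewrite big_nil.
rewrite big_cons -IH; case: ifP => Pi.
  by rewrite -walkED; congr walkE; apply/funext => y; rewrite big_cons Pi.
by congr walkE; apply/funext => y; rewrite big_cons Pi.
Qed.

Definition cosetP W B z : R := walkE B (fun y => (y - z \in W)%:R).

Lemma cosetP_ge0 W B z : 0 <= cosetP W B z.
Proof. by apply: walkE_ge0 => y; rewrite ler0n. Qed.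

Lemma cosetP_le1 W B z : cosetP W B z <= 1.
Proof. by rewrite -[leRHS](walkE_cst B) walkE_le// => y; rewrite lern1 leq_b1. Qed.

Lemma cosetPD W B z w : w \in W -> cosetP W B (z + w) = cosetP W B z.
Proof.
move=> wW; congr walkE; apply/funext => y; congr (_ %:R).
by rewrite opprD addrA rpredBr.
Qed.

Lemma cosetP_cons W b B z :
  cosetP W (b :: B) z = \sum_(x <- Xs) nu b x * cosetP W B (z - b%:R *: x).
Proof.
rewrite /cosetP /=; apply: eq_bigr => x _; congr (_ * walkE _ _).
by apply/funext => y; rewrite opprB addrCA addrA addrC.
Qed.

Variable q : R.
Hypothesis q01 : 0 < q < 1.

Definition moment W B (s : 'rV[rat]_k) : R := walkE B (fun y => cosetP W B (y + s) `^ q).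

Lemma moment_ge0 W B s : 0 <= moment W B s.
Proof. by apply: walkE_ge0 => y; rewrite powR_ge0. Qed.

Lemma moment_le1 W B s : moment W B s <= 1.
Proof.
have /andP[q0 _] := q01.
rewrite -[leRHS](walkE_cst B) walkE_le// => y.
have e : 1 `^ q = 1 :> R by rewrite powR1.
by rewrite -[leRHS]e ge0_ler_powR ?nnegrE ?cosetP_ge0 ?cosetP_le1// ltW.
Qed.

(** The mean of [m (x + W) ^ q] for [x] of law [m]; to first order in [q] it is one
    minus [q] times the entropy of [m] modulo [W]. *)
Definition coset_power (m : 'rV[rat]_k -> R) W : R :=
  \sum_(x <- Xs) m x * (\sum_(x' <- Xs | x - x' \in W) m x') `^ q.

(** Conditioning on the values [x] and [x'] of two independent paths at the new
    element: the [x'] congruent to [x] modulo [W] leave the coset unchanged and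
    are kept together, the others are separated by subadditivity of the power. *)
Lemma moment_cons W b B s :
  moment W (b :: B) s <= coset_power (nu b) W * moment W B s
    + \sum_(x <- Xs) \sum_(x' <- Xs | x - x' \notin W)
        nu b x * nu b x' `^ q * moment W B (s + b%:R *: (x - x')).
Proof.
rewrite /coset_power mulr_suml -big_split/= [leLHS]/=; apply: ler_sum => x _.
have -> : nu b x * (\sum_(x' <- Xs | x - x' \in W) nu b x') `^ q * moment W B s
  + \sum_(x' <- Xs | x - x' \notin W)
        nu b x * nu b x' `^ q * moment W B (s + b%:R *: (x - x'))
  = nu b x * walkE B (fun y =>
     (\sum_(x' <- Xs | x - x' \in W) nu b x') `^ q * cosetP W B (y + s) `^ q
     + \sum_(x' <- Xs | x - x' \notin W)
        nu b x' `^ q * cosetP W B (y + (s + b%:R *: (x - x'))) `^ q).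
  rewrite walkED walkEZ walkE_sum mulrDr mulrA mulr_sumr; congr (_ + _).
  by apply: eq_bigr => x' _; rewrite walkEZ mulrA.
rewrite ler_wpM2l//; apply: walkE_le => y.
have zE x' : b%:R *: x + y + s - b%:R *: x' = y + s + b%:R *: (x - x').
  by apply/matrixP => i j; rewrite !mxE; ring.
rewrite cosetP_cons (bigID (fun x' => x - x' \in W))/=.
under eq_bigr => x' xx' do rewrite zE cosetPD ?memvZ//.
under [X in _ + X]eq_bigr => x' _ do rewrite zE.
rewrite -mulr_suml.
have p0 : 0 <= \sum_(x' <- Xs | x - x' \in W) nu b x' by rewrite sumr_ge0.
apply: le_trans (powR_subadd q01 _ _) _.
- by rewrite mulr_ge0 ?cosetP_ge0.
- by rewrite sumr_ge0// => i _; rewrite mulr_ge0 ?cosetP_ge0.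
rewrite powRM ?cosetP_ge0// lerD2l.
apply: le_trans (powR_sum_le q01 _ _ _) _ => [x'|].
  by rewrite mulr_ge0 ?cosetP_ge0.
rewrite le_eqVlt; apply/orP; left; apply/eqP; apply: eq_bigr => x' _.
by rewrite (powRM _ (nu_ge0 _ _) (cosetP_ge0 _ _ _)) (addrA y).
Qed.

(** A point [y + b v] determines [b] modulo [W] when [v] is outside [W], so the
    events behind the summands are disjoint and contained in a single coset of
    [W + <v>]; concavity moves the sum inside the power. *)
Lemma moment_sum W B (s v : 'rV[rat]_k) (bs : seq nat) :
  v \notin W -> uniq bs ->
  \sum_(b <- bs) moment W B (s + b%:R *: v)
    <= (size bs)%:R `^ (1 - q) * moment (W + <[v]>) B s.
Proof.
move=> vW ubs; have /andP[q0 q1] := q01.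
rewrite /moment -walkE_sum -walkEZ; apply: walkE_le => y.
apply: le_trans (sum_powR_le q01 _ _) _ => [b|]; first exact: cosetP_ge0.
rewrite ler_wpM2l ?powR_ge0// ge0_ler_powR ?nnegrE ?cosetP_ge0 ?(ltW q0)//.
  by rewrite sumr_ge0// => b _; rewrite cosetP_ge0.
rewrite /cosetP -walkE_sum; apply: walkE_le => z.
pose f b := z - (y + (s + b%:R *: v)) \in W.
have fE b : f b -> z - (y + s) \in (W + <[v]>)%VS.
  move=> fb; rewrite -(subrK (b%:R *: v) (z - (y + s))).
  apply: memv_add; last by rewrite memvZ ?memv_line.
  by move: fb; rewrite /f addrA opprD addrA.
have f_inj b b' : f b -> f b' -> b = b'.
  move=> fb fb'; apply/eqP; apply: contraT => bb'.
  have : (b%:R - b'%:R) *: v \in W.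
    have -> : (b%:R - b'%:R) *: v
        = (z - (y + (s + b'%:R *: v))) - (z - (y + (s + b%:R *: v))).
      by apply/matrixP => i j; rewrite !mxE; ring.
    exact: rpredB.
  by rewrite rpredZeq subr_eq0 eqr_nat (negbTE bb') (negbTE vW).
have [/hasP[b0 b0s fb0]|] := boolP (has f bs); last first.
  rewrite -all_predC => /allP nf; rewrite big_seq big1 ?ler0n// => b /nf /=.
  by rewrite /f => /negbTE ->.
rewrite (fE _ fb0) (bigD1_seq b0)//= big1 ?addr0; last first.
  move=> b bb0; case: (boolP (_ \in W)) => // fb.
  by rewrite (f_inj _ _ fb fb0) eqxx in bb0.
by rewrite lern1 leq_b1.
Qed.

End Walk.

(** * The moment averaged over the random set *)

Section ActiveElements.
Variable inI : pred nat.

(** Listed in decreasing order, so that going from [n] to [n + 1] is a [cons]. *)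
Fixpoint active n : seq nat :=
  if n is m.+1 then if inI m.+1 then m.+1 :: active m else active m else [::].

Lemma active_mem n b : (b \in active n) = (0 < b <= n)%N && inI b.
Proof.
elim: n => [|n IH] /=; first by case: b.
have E : (0 < b <= n.+1)%N = (b == n.+1) || (0 < b <= n)%N.
  by apply/idP/idP; lia.
case: ifP => In; rewrite ?inE IH E; case: eqP => [->|//]; rewrite ?In//=.
by rewrite andbF.
Qed.

Lemma active_gt0 n b : b \in active n -> (0 < b)%N.
Proof. by rewrite active_mem => /andP[/andP[]]. Qed.

Lemma active_uniq n : uniq (active n).
Proof.
elim: n => [//|n IH] /=; case: ifP => In //=.
by rewrite IH active_mem ltnn !andbF.
Qed.

End ActiveElements.

Section MeanMoment.
Variables (R : realType) (k : nat) (Xs : seq 'rV[rat]_k).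
Variables (nu : nat -> 'rV[rat]_k -> R) (q : R) (inI : pred nat).
Hypothesis nu_ge0 : forall b x, 0 <= nu b x.
Hypothesis nu_sum : forall b, \sum_(x <- Xs) nu b x = 1.
Hypothesis q01 : 0 < q < 1.
Implicit Types (W U : {vspace 'rV[rat]_k}) (s v : 'rV[rat]_k).

Definition meanM n W s : R :=
  sublistE (active inI n) (fun B => moment Xs nu q W B s).

Lemma meanM_ge0 n W s : 0 <= meanM n W s.
Proof.
rewrite -(sublistE_cst (active inI n) 0); apply: sublistE_le => [b|B _].
  exact: active_gt0.
exact: moment_ge0.
Qed.

Lemma meanM_le1 n W s : meanM n W s <= 1.
Proof.
rewrite -[leRHS](sublistE_cst (active inI n)); apply: sublistE_le => [b|B _].
  exact: active_gt0.
exact: moment_le1.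
Qed.

Lemma meanM_skip n n' W s : (n <= n')%N ->
  (forall b, (n < b <= n')%N -> ~~ inI b) -> meanM n' W s = meanM n W s.
Proof.
move=> /subnKC <-; elim: (n' - n)%N => [|l IH] nI; first by rewrite addn0.
rewrite -IH => [|b bl]; last by apply: nI; lia.
by rewrite addnS /meanM /= (negbTE (nI _ _))//; lia.
Qed.

Lemma meanM_step n W s : inI n.+1 ->
  meanM n.+1 W s
  <= (1 - (1 - coset_power Xs q (nu n.+1) W) / n.+1%:R) * meanM n W s
     + n.+1%:R^-1 * \sum_(x <- Xs) \sum_(x' <- Xs | x - x' \notin W)
        nu n.+1 x * nu n.+1 x' `^ q * meanM n W (s + n.+1%:R *: (x - x')).
Proof.
move=> In.
have key : sublistE (active inI n) (fun B => moment Xs nu q W (n.+1 :: B) s)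
    <= coset_power Xs q (nu n.+1) W * meanM n W s
       + \sum_(x <- Xs) \sum_(x' <- Xs | x - x' \notin W)
        nu n.+1 x * nu n.+1 x' `^ q * meanM n W (s + n.+1%:R *: (x - x')).
  rewrite /meanM -sublistEZ.
  under [X in _ + X]eq_bigr => x _.
    under eq_bigr => x' _ do rewrite -sublistEZ.
    rewrite -sublistE_sum; over.
  rewrite -sublistE_sum -sublistED.
  apply: sublistE_le => [b|B _]; first exact: active_gt0.
  exact: moment_cons.
have /andP[b0 _] := @invn_itv R n.+1 isT.
have -> : meanM n.+1 W s = (1 - n.+1%:R^-1) * meanM n W s
   + n.+1%:R^-1 * sublistE (active inI n) (fun B => moment Xs nu q W (n.+1 :: B) s).
  by rewrite {1}/meanM /= In.
apply: le_trans (lerD (lexx _) (ler_wpM2l b0 key)) _.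
rewrite le_eqVlt; apply/orP; left; apply/eqP; ring.
Qed.

Lemma meanM_sum n W s v (bs : seq nat) : v \notin W -> uniq bs ->
  \sum_(b <- bs) meanM n W (s + b%:R *: v)
    <= (size bs)%:R `^ (1 - q) * meanM n (W + <[v]>) s.
Proof.
move=> vW ubs; rewrite /meanM -sublistE_sum -sublistEZ.
apply: sublistE_le => [b|B _]; first exact: active_gt0.
exact: moment_sum.
Qed.

Section Block.
Variables (m : 'rV[rat]_k -> R) (U W : {vspace 'rV[rat]_k}) (n l : nat).
Hypothesis m_ge0 : forall x, 0 <= m x.
Hypothesis m_sum : \sum_(x <- Xs) m x = 1.
Hypothesis m_supp : forall x, m x != 0 -> x \in U.
Hypothesis n_gt0 : (0 < n)%N.
Hypothesis l_le : (l <= 3 * n)%N.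
Hypothesis nuE : forall b, (n < b <= n + l)%N -> inI b /\ nu b = m.

Let rho := coset_power Xs q m W.
Let kap : R := (size Xs)%:R.
Let H (i : nat) : R := \sum_(j < i) (n + j).+1%:R^-1.

Lemma mass_le1 (P : pred 'rV[rat]_k) : \sum_(x <- Xs | P x) m x <= 1.
Proof. by rewrite -m_sum big_mkcond/=; apply: ler_sum => x _; case: ifP. Qed.

Lemma coset_power_le1 : rho <= 1.
Proof.
rewrite -m_sum; apply: ler_sum => x _.
rewrite -[leRHS]mulr1 ler_wpM2l//.
have e : 1 `^ q = 1 :> R by rewrite powR1.
have /andP[/ltW q0 _] := q01.
by rewrite -[leRHS]e ge0_ler_powR ?nnegrE ?sumr_ge0 ?mass_le1.
Qed.

Lemma powm_le1 x : x \in Xs -> m x `^ q <= 1.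
Proof.
move=> xX; have e : 1 `^ q = 1 :> R by rewrite powR1.
have /andP[/ltW q0 _] := q01.
rewrite -[leRHS]e ge0_ler_powR ?nnegrE//.
by rewrite -m_sum (big_rem x)//= lerDl sumr_ge0.
Qed.

(** The weights [m x * m x' ^ q] add up to at most the size of [Xs]; a pair with a
    point outside [U] has weight zero, as [m] is supported in [U]. *)
Lemma pair_sum_le (f : 'rV[rat]_k -> 'rV[rat]_k -> R) (c : R) : 0 <= c ->
  (forall x x', x - x' \in U -> x - x' \notin W -> f x x' <= c) ->
  \sum_(x <- Xs) \sum_(x' <- Xs | x - x' \notin W) m x * m x' `^ q * f x x'
    <= kap * c.
Proof.
move=> c0 fc; have /andP[q0 _] := q01.
apply: (@le_trans _ _ (\sum_(x <- Xs) m x * (kap * c))); last first.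
  by rewrite -mulr_suml m_sum mul1r.
apply: ler_sum => x _.
have -> : kap * c = \sum_(x' <- Xs) c.
  by rewrite big_const_seq count_predT iter_addr_0 -mulr_natl.
have [mx0|mx0] := eqVneq (m x) 0.
  by rewrite mx0 mul0r big1// => x' _; rewrite !mul0r.
rewrite mulr_sumr big_mkcond/= big_seq [leRHS]big_seq.
apply: ler_sum => x' xX'; case: ifP => xW; last by rewrite mulr_ge0.
rewrite -mulrA; apply: ler_wpM2l; first exact: m_ge0.
have [mx'0|mx'0] := eqVneq (m x') 0; first by rewrite mx'0 powR0 ?gt_eqF// mul0r.
apply: (@le_trans _ _ (m x' `^ q * c)).
  by rewrite ler_wpM2l ?powR_ge0// fc// rpredB ?m_supp.
by rewrite ler_piMl// powm_le1.
Qed.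

(** Over the scales from [n] to [n + l] the mean moments are dominated by one
    function [g], obtained by forgetting that an element may be absent and by
    allowing all shifts.  Each step convolves [g] with a positive measure, which
    multiplies any uniform bound on the weighted sums of translates by the total
    mass of that measure.  A single [g] for all scales is what allows
    [meanM_sum] to be applied at the fixed scale [n]. *)
Lemma block_majorant (L : R) (bs : seq nat) : 0 <= L ->
  (forall v s, v \in U -> v \notin W ->
     \sum_(b <- bs) b%:R^-1 * meanM n W (s + b%:R *: v) <= L) ->
  forall i, (i <= l)%N -> exists g : 'rV[rat]_k -> R,
  [/\ forall s, 0 <= g s,
      forall j s, (j <= i)%N -> meanM (n + j) W s <= g s &
      forall v s, v \in U -> v \notin W ->
        \sum_(b <- bs) b%:R^-1 * g (s + b%:R *: v) <= L * expR (kap * H i)].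
Proof.
move=> L0 HL; elim=> [_|i IH il].
  exists (meanM n W); split=> [s|j s|v s vU vW]; first exact: meanM_ge0.
    by rewrite leqn0 => /eqP->; rewrite addn0.
  by rewrite /H big_ord0 mulr0 expR0 mulr1 HL.
have [g [g0 gM gS]] := IH (ltnW il).
set B : R := (n + i).+1%:R.
have B0 : 0 < B by rewrite ltr0n.
pose g' s := g s + B^-1 * \sum_(x <- Xs) \sum_(x' <- Xs | x - x' \notin W)
   m x * m x' `^ q * g (s + (n + i).+1%:R *: (x - x')).
have cg0 s : 0 <= \sum_(x <- Xs) \sum_(x' <- Xs | x - x' \notin W)
   m x * m x' `^ q * g (s + (n + i).+1%:R *: (x - x')).
  by rewrite !sumr_ge0// => x _; rewrite sumr_ge0// => x' _; rewrite !mulr_ge0 ?powR_ge0.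
have [In nuB] : inI (n + i).+1 /\ nu (n + i).+1 = m by apply: nuE; lia.
exists g'; split=> [s|j s|v s vU vW].
- by rewrite /g' addr_ge0// mulr_ge0// ?invr_ge0 ?(ltW B0)//.
- rewrite leq_eqVlt => /orP[/eqP->|ji]; last first.
    by rewrite (le_trans (gM j s ji))// lerDl mulr_ge0// invr_ge0 ltW.
  rewrite addnS; apply: le_trans (meanM_step _ _ In) _; rewrite nuB -/rho -/B.
  apply: lerD; last first.
    rewrite ler_wpM2l ?invr_ge0 ?(ltW B0)//.
    apply: ler_sum => x _; apply: ler_sum => x' _.
    by rewrite ler_wpM2l ?mulr_ge0 ?powR_ge0// gM.
  apply: le_trans (gM i s (leqnn _)); rewrite ler_piMl ?meanM_ge0//.
  by rewrite gerBl mulr_ge0 ?invr_ge0 ?(ltW B0)// subr_ge0 coset_power_le1.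
- rewrite /H big_ord_recr/= -/(H i) -/B mulrDr expRD mulrA.
  set e := L * expR _.
  have e0 : 0 <= e by rewrite mulr_ge0 ?expR_ge0.
  apply: (@le_trans _ _ (e * (1 + kap * B^-1))); last by rewrite ler_wpM2l// expR_ge1Dx.
  rewrite /g'; under eq_bigr do rewrite mulrDr.
  rewrite big_split/= mulrDr mulr1; apply: lerD; first exact: gS.
  have -> : \sum_(b <- bs) b%:R^-1 * (B^-1 * \sum_(x <- Xs) \sum_(x' <- Xs | x - x' \notin W)
      m x * m x' `^ q * g (s + b%:R *: v + (n + i).+1%:R *: (x - x')))
    = B^-1 * \sum_(x <- Xs) \sum_(x' <- Xs | x - x' \notin W) m x * m x' `^ q *
       (\sum_(b <- bs) b%:R^-1 * g (s + (n + i).+1%:R *: (x - x') + b%:R *: v)).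
    under eq_bigr do rewrite mulrCA.
    rewrite -mulr_sumr; congr (_ * _).
    under eq_bigr do rewrite mulr_sumr.
    rewrite exchange_big; apply: eq_bigr => x _.
    under eq_bigr do rewrite mulr_sumr.
    rewrite exchange_big; apply: eq_bigr => x' _.
    rewrite mulr_sumr; apply: eq_bigr => b _.
    by rewrite mulrCA; congr (_ * (_ * g _)); rewrite -!addrA; congr (_ + _); exact: addrC.
  have -> : e * (kap * B^-1) = B^-1 * (kap * e) by ring.
  rewrite ler_wpM2l ?invr_ge0 ?(ltW B0)//.
  by apply: (pair_sum_le e0) => x x' xU xW; exact: gS.
Qed.

(** Paths that agree modulo [W] on the whole block give the first term.  The second
    one sums, over the largest element [b] of the block at which they differ
    modulo [W], the shifted moments at scale [b - 1], all bounded through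
    [block_majorant]. *)
Lemma block_bound (al be : R) : 0 <= be ->
  (forall s, meanM n W s <= al) ->
  (forall v s, v \in U -> v \notin W -> meanM n (W + <[v]>) s <= be) ->
  forall s, meanM (n + l) W s
    <= expR (- (1 - rho) * H l) * al
       + 3 * kap * expR (3 * kap) * n%:R `^ (- q) * be.
Proof.
move=> be0 Hal Hbe s; have /andP[q0 q1] := q01.
have n0 : 0 < n%:R :> R by rewrite ltr0n.
have nq0 : 0 <= n%:R `^ (- q) :> R by exact: powR_ge0.
pose L : R := 3 * n%:R `^ (- q) * be.
have L0 : 0 <= L by rewrite !mulr_ge0.
have Hl : H l <= 3.
  apply: (@le_trans _ _ (\sum_(j < l) n%:R^-1)).
    by apply: ler_sum => j _; rewrite lef_pV2 ?posrE ?ltr0n// ler_nat; lia.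
  rewrite sumr_const card_ord -[_ *+ l]mulr_natl ler_pdivrMr// -natrM ler_nat//.
have [|g [g0 gM gS]] := @block_majorant L (iota n.+1 l) L0 _ l (leqnn l).
  move=> v s' vU vW.
  apply: (@le_trans _ _ (n%:R^-1 * \sum_(b <- iota n.+1 l) meanM n W (s' + b%:R *: v))).
    rewrite mulr_sumr big_seq [leRHS]big_seq; apply: ler_sum => b.
    rewrite mem_iota => bl; rewrite ler_wpM2r ?meanM_ge0//.
    by rewrite lef_pV2 ?posrE ?ltr0n// ?ler_nat; lia.
  apply: le_trans (ler_wpM2l _ (meanM_sum _ _ vW (iota_uniq _ _))) _.
    by rewrite invr_ge0 ltW.
  rewrite mulrA /L; apply: ler_pM => //;
    rewrite ?mulr_ge0 ?invr_ge0 ?powR_ge0 ?meanM_ge0 ?(ltW n0)//; last exact: Hbe.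
  rewrite size_iota.
  apply: (@le_trans _ _ (n%:R^-1 * (3 * n%:R) `^ (1 - q))).
    rewrite ler_wpM2l ?invr_ge0 ?(ltW n0)// ge0_ler_powR ?nnegrE ?mulr_ge0 ?ler0n//.
      by rewrite subr_ge0 ltW.
    by rewrite -natrM ler_nat.
  rewrite powRM ?(ltW n0)// mulrCA.
  rewrite (_ : n%:R^-1 * n%:R `^ (1 - q) = n%:R `^ (- q)); last first.
    rewrite -(powR_inv1 (ltW n0)) -powRD ?(gt_eqF n0) ?implybT//.
    by congr (_ `^ _); ring.
  rewrite ler_wpM2r// ler1_powR//; lra.
have step i : (i <= l)%N -> meanM (n + i) W s <= expR (- (1 - rho) * H i) * al
    + \sum_(x <- Xs) \sum_(x' <- Xs | x - x' \notin W) m x * m x' `^ q *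
       (\sum_(j < i) (n + j).+1%:R^-1 * meanM (n + j) W (s + (n + j).+1%:R *: (x - x'))).
  elim: i => [_|i IH il].
    rewrite addn0 /H big_ord0 mulr0 expR0 mul1r big1 ?addr0//.
    by move=> x _; rewrite big1// => x' _; rewrite big_ord0 mulr0.
  have [In nuB] : inI (n + i).+1 /\ nu (n + i).+1 = m by apply: nuE; lia.
  rewrite addnS; apply: le_trans (meanM_step _ _ In) _; rewrite nuB -/rho.
  set B : R := (n + i).+1%:R.
  have B0 : 0 < B by rewrite ltr0n.
  have r1 : 0 <= 1 - rho by rewrite subr_ge0 coset_power_le1.
  have {}IH := IH (ltnW il).
  under [X in _ <= _ + X]eq_bigr => x _.
    under eq_bigr => x' _ do rewrite big_ord_recr/= mulrDr.
    rewrite big_split/=; over.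
  rewrite big_split/= addrA; apply: lerD; last first.
    rewrite mulr_sumr; apply: ler_sum => x _; rewrite mulr_sumr.
    by apply: ler_sum => x' _; rewrite mulrCA.
  set A := \sum_(x <- Xs) _ in IH *.
  have A0 : 0 <= A.
    apply: sumr_ge0 => x _; apply: sumr_ge0 => x' _.
    rewrite !mulr_ge0 ?powR_ge0//; apply: sumr_ge0 => j _.
    by rewrite mulr_ge0 ?invr_ge0 ?ler0n ?meanM_ge0.
  have al0 : 0 <= al := le_trans (meanM_ge0 n W s) (Hal s).
  have B1 : B^-1 <= 1 by have /andP[] := @invn_itv R (n + i).+1 isT.
  have rho0 : 0 <= rho.
    by apply: sumr_ge0 => x _; rewrite mulr_ge0 ?powR_ge0.
  have a1 : 0 <= 1 - (1 - rho) / B.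
    by rewrite subr_ge0 (@le_trans _ _ (1 / B)) ?ler_wpM2r ?invr_ge0 ?(ltW B0)//
       ?mul1r// gerBl.
  apply: le_trans (ler_wpM2l a1 IH) _.
  rewrite mulrDr; apply: lerD; last first.
    by rewrite ler_piMl// gerBl mulr_ge0// invr_ge0 ltW.
  rewrite mulrA ler_wpM2r// /H big_ord_recr/= -/(H i) mulrDr expRD mulrC.
  by rewrite ler_wpM2l ?expR_ge0// mulNr expR_ge1Dx.
apply: le_trans (step l (leqnn l)) _; rewrite lerD2l.
have -> : 3 * kap * expR (3 * kap) * n%:R `^ (- q) * be
  = kap * (L * expR (3 * kap)) by rewrite /L; ring.
apply: pair_sum_le => [|x x' xU xW]; first by rewrite mulr_ge0 ?expR_ge0.
apply: (@le_trans _ _ (L * expR (kap * H l))); last first.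
  by rewrite ler_wpM2l// ler_expR mulrC ler_wpM2r ?ler0n.
apply: le_trans (gS _ s xU xW).
rewrite -(addn0 n.+1) iotaDl big_map -[X in iota 0 X]subn0 big_mkord.
apply: ler_sum => j _; rewrite addSn ler_wpM2l ?invr_ge0 ?ler0n// gM//.
exact/ltnW.
Qed.

End Block.
End MeanMoment.

(** * Moments of coset masses and entropy *)

Section CosetPowerEntropy.
Variables (R : realType) (k : nat) (Xs : seq 'rV[rat]_k) (q L : R).
Variable m : 'rV[rat]_k -> R.
Hypothesis q01 : 0 < q < 1.
Hypothesis m_ge0 : forall x, 0 <= m x.
Hypothesis m_sum : \sum_(x <- Xs) m x = 1.
Hypothesis L_ge0 : 0 <= L.
Hypothesis m_log : forall x : 'rV[rat]_k, x \in Xs -> m x != 0 -> - ln (m x) <= L.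
Implicit Types (W : {vspace 'rV[rat]_k}) (x : 'rV[rat]_k).

(** The entropy of [m] modulo [W] as a finite sum over [Xs]; see [entropyH_coset]. *)
Definition coset_entropy (m : 'rV[rat]_k -> R) W : R :=
  - \sum_(x <- Xs) m x * ln (\sum_(x' <- Xs | x - x' \in W) m x').

Lemma expR_quadratic (y : R) : y <= 0 -> expR y <= 1 + y + y ^+ 2.
Proof.
move=> y0; have y1 : 0 < 1 - y by lra.
have : expR y <= (1 - y)^-1.
  rewrite -[expR y]invrK lef_pV2 ?posrE ?invr_gt0 ?expR_gt0//.
  by rewrite -expRN expR_ge1Dx.
move=> /le_trans; apply.
rewrite -[leLHS]mul1r ler_pdivrMr//.
have : y ^+ 3 <= 0 by rewrite exprSr; nra.
rewrite (_ : (1 + y + y ^+ 2) * (1 - y) = 1 - y ^+ 3); last by ring.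
lra.
Qed.

Lemma coset_mass_bounds W x : x \in Xs -> m x != 0 ->
  0 <= - ln (\sum_(x' <- Xs | x - x' \in W) m x') <= L
  /\ 0 < \sum_(x' <- Xs | x - x' \in W) m x'.
Proof.
move=> xX mx0; set p := \sum_(x' <- Xs | _) _.
have mx_gt0 : 0 < m x by rewrite lt_def mx0 m_ge0.
have mp : m x <= p.
  by rewrite /p (big_rem x)//= subrr mem0v lerDl sumr_ge0.
have p1 : p <= 1.
  by rewrite -m_sum /p big_mkcond/=; apply: ler_sum => x' _; case: ifP.
have p0 : 0 < p := lt_le_trans mx_gt0 mp.
split=> //; rewrite oppr_ge0 ln_le0//= (le_trans _ (m_log xX mx0))//.
by rewrite lerN2 ler_ln.
Qed.

Lemma coset_entropy_itv W : 0 <= coset_entropy m W <= L.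
Proof.
rewrite /coset_entropy -sumrN; apply/andP; split.
  rewrite big_seq; apply: sumr_ge0 => x xX; rewrite -mulrN.
  have [->|mx0] := eqVneq (m x) 0; first by rewrite mul0r.
  have [/andP[p0 _] _] := coset_mass_bounds W xX mx0; exact: mulr_ge0.
rewrite -[leRHS]mul1r -m_sum mulr_suml big_seq [leRHS]big_seq.
apply: ler_sum => x xX; rewrite -mulrN.
have [->|mx0] := eqVneq (m x) 0; first by rewrite !mul0r.
have [/andP[_ pL] _] := coset_mass_bounds W xX mx0; exact: ler_wpM2l.
Qed.

(** Expand [p ^ q = exp (q ln p)] to second order in each term, where [- ln p] is at
    most [L]. *)
Lemma coset_power_entropy W :
  q * (coset_entropy m W - q * L ^+ 2) <= 1 - coset_power Xs q m W.
Proof.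
have /andP[q0 q1] := q01.
rewrite lerBrDr -lerBrDl.
have -> : 1 - q * (coset_entropy m W - q * L ^+ 2) = \sum_(x <- Xs)
    m x * (1 + q * ln (\sum_(x' <- Xs | x - x' \in W) m x') + (q * L) ^+ 2).
  under eq_bigr do rewrite mulrDr mulrDr mulr1.
  rewrite !big_split/= -mulr_suml m_sum mul1r.
  under eq_bigr do rewrite mulrCA.
  rewrite -mulr_sumr /coset_entropy; ring.
rewrite /coset_power big_seq [leRHS]big_seq; apply: ler_sum => x xX.
have [->|mx0] := eqVneq (m x) 0; first by rewrite !mul0r.
have [/andP[p0 pL] pp] := coset_mass_bounds W xX mx0.
rewrite ler_wpM2l// /powR (gt_eqF pp).
apply: le_trans (expR_quadratic _) _; first by nra.
rewrite lerD2l -sqrrN ler_sqr ?nnegrE; nra.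
Qed.

End CosetPowerEntropy.

(** Compare each [1 / i] with [ln (i + 1) - ln i]. *)
Lemma sum_inv_ge_ln (R : realType) (n l : nat) : (0 < n)%N ->
  ln (n + l)%:R - ln n%:R - n%:R^-1 <= \sum_(j < l) (n + j).+1%:R^-1 :> R.
Proof.
move=> n0; have np (i : nat) : (0 < i)%N -> 0 < i%:R :> R by rewrite ltr0n.
have lnS (i : nat) : (0 < i)%N -> ln i.+1%:R - ln i%:R <= i%:R^-1 :> R.
  move=> i0; rewrite -ln_div ?posrE ?np//.
  have -> : i.+1%:R / i%:R = 1 + i%:R^-1 :> R.
    by rewrite -natr1 mulrDl mul1r divff ?gt_eqF ?np.
  by rewrite -[leRHS]expRK ler_ln ?posrE ?expR_gt0 ?expR_ge1Dx// addr_gt0// invr_gt0 np.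
have H : ln (n + l).+1%:R - ln n.+1%:R <= \sum_(j < l) (n + j).+1%:R^-1 :> R.
  elim: l => [|l IH]; first by rewrite big_ord0 addn0 subrr.
  rewrite big_ord_recr/=; apply: le_trans (lerD IH (lnS (n + l).+1 isT)).
  by rewrite addnS; lra.
have := lnS n n0; have : ln (n + l)%:R <= ln (n + l).+1%:R :> R.
  by rewrite ler_ln ?posrE ?ltr0n ?ler_nat ?addn_gt0 ?n0.
lra.
Qed.

(** * Costs of flags *)

Section FlagCost.
Variables (R : realType) (k r : nat) (V : nat -> {vspace 'rV[rat]_k}).
Variables (h : nat -> {vspace 'rV[rat]_k} -> R) (la lt : nat -> R).
Implicit Types (W : {vspace 'rV[rat]_k}) (F : nat -> {vspace 'rV[rat]_k}).

(** The part from index [j - 1] on of a subflag that has [W] at index [j - 1]. *)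
Definition flag_tail (j : nat) W F : Prop :=
  F j.-1 = W /\ forall i, (j <= i <= r)%N -> (F i.-1 <= F i)%VS /\ (F i <= V i)%VS.

Definition dimD F (j : nat) : R := (\dim (F j))%:R - (\dim (F j.-1))%:R.

Definition block_cost F (i : nat) : R :=
  lt i * dimD F i + h i (F i) * (lt i - la i).

(** The exponent lost by pairs of paths whose differences span [F j.-1] above the
    scale [exp u] of block [j], then [F j] in the rest of block [j], and [F i] in
    each lower block [i].  A jump of the span costs its dimension times the
    logarithm of its scale, and remaining in [F i] costs [h i (F i)] per unit of
    logarithmic scale. *)
Definition tail_cost (j : nat) (u : R) F : R :=
  u * dimD F j + h j (F j) * (u - la j) + \sum_(j.+1 <= i < r.+1) block_cost F i.

Definition flag_upd F (j : nat) W : nat -> {vspace 'rV[rat]_k} :=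
  fun i => if i == j then W else F i.

Lemma flag_upd_id F j W : flag_upd F j W j = W.
Proof. by rewrite /flag_upd eqxx. Qed.

Lemma flag_upd_neq F j W i : i != j -> flag_upd F j W i = F i.
Proof. by rewrite /flag_upd => /negbTE ->. Qed.

Lemma block_cost_upd F j W i : i != j -> i.-1 != j ->
  block_cost (flag_upd F j W) i = block_cost F i.
Proof. by move=> ij i1j; rewrite /block_cost /dimD !flag_upd_neq. Qed.

Lemma sum_block_cost_upd F l W n : (l.+1 < n)%N ->
  \sum_(n <= i < r.+1) block_cost (flag_upd F l W) i
  = \sum_(n <= i < r.+1) block_cost F i.
Proof. by move=> ln; apply: eq_big_nat => i ij; rewrite block_cost_upd//; lia. Qed.

Lemma flag_tail_last j W F : (0 < j <= r)%N -> flag_tail j W F -> (W <= V j)%VS.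
Proof.
move=> /andP[j0 jr] [<- FV]; have [//|Fj1 Fj] := FV j; first by rewrite leqnn.
exact: subv_trans Fj.
Qed.

(** Jumping from [W] to [W'] at scale [exp u] and then following [F]. *)
Lemma tail_cost_first j u F W W' : (0 < j)%N -> flag_tail j W' F -> (W <= W')%VS ->
  flag_tail j W (flag_upd F j.-1 W)
  /\ tail_cost j u (flag_upd F j.-1 W)
     = tail_cost j u F + u * ((\dim W')%:R - (\dim W)%:R).
Proof.
move=> j0 [F0 FV] WW'; split.
  split=> [|i ij]; first by rewrite /flag_upd eqxx.
  have [Fi1 Fi] := FV i ij; rewrite /flag_upd.
  rewrite (_ : (i == j.-1) = false); last by apply/negbTE; lia.
  split=> //; case: eqP => // e; apply: subv_trans WW' _.
  by rewrite -F0 -e.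
rewrite /tail_cost /dimD flag_upd_id flag_upd_neq ?F0; last by lia.
rewrite sum_block_cost_upd; last by lia.
ring.
Qed.

(** The cost of a jump is linear in its scale, so it is minimal at one of the two
    ends of the block.  With [s] the slope: if [s <= 0] the jump made at [u] can
    as well be made at [u']; if [s > 0] it is cheaper to stay in [W] throughout
    the block and to jump at its bottom, that is, to set [F j] to [W]. *)
Lemma tail_cost_slope j u u' F W : (0 < j <= r)%N -> flag_tail j W F ->
  0 <= la j -> la j <= u -> u <= u' -> ((j < r)%N -> lt j.+1 <= la j) ->
  exists2 F', flag_tail j W F' &
    tail_cost j u' F' <= tail_cost j u F + h j W * (u' - u).
Proof.
move=> /andP[j0 jr] Ft la0 lau uu' ltla; have [F0 FV] := Ft.
have jm : j.-1 != j by case: (j) j0 => // j' _; rewrite neq_ltn ltnSn.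
have [|Fj1 FjV] := FV j; first by rewrite leqnn.
pose s : R := dimD F j + h j (F j) - h j W.
have [s0|s0] := leP s 0.
  exists F => //; rewrite /tail_cost -subr_ge0.
  set S := \sum_(_ <= _ < _) _.
  have -> : u * dimD F j + h j (F j) * (u - la j) + S + h j W * (u' - u)
    - (u' * dimD F j + h j (F j) * (u' - la j) + S) = - s * (u' - u).
    by rewrite /s; ring.
  by rewrite mulr_ge0// ?oppr_ge0// subr_ge0.
have dj : 0 <= dimD F j by rewrite subr_ge0 ler_nat dimvS.
have cost0 : u * dimD F j + h j (F j) * (u - la j) =
   s * (u - la j) + h j W * (u - la j) + la j * dimD F j by rewrite /s; ring.
have su : 0 <= s * (u - la j) by rewrite mulr_ge0 ?(ltW s0) ?subr_ge0.
have updE i := @flag_upd_neq F j W i.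
exists (flag_upd F j W).
  split=> [|i ij]; first by rewrite updE.
  have [Fi1 Fi] := FV i ij.
  have [->|inj] := eqVneq i j.
    rewrite (updE _ jm) F0 flag_upd_id; split=> //.
    by apply: flag_tail_last Ft; rewrite j0.
  rewrite (updE i)//; split=> //; rewrite /flag_upd; case: eqP => // e.
  by apply: subv_trans Fi1; rewrite -F0 e.
rewrite /tail_cost cost0.
have -> : dimD (flag_upd F j W) j = 0.
  by rewrite /dimD (updE _ jm) F0 flag_upd_id subrr.
rewrite flag_upd_id mulr0 add0r.
set S1 := \sum_(_ <= _ < _) _; set S2 := \sum_(_ <= _ < _) _.
suff : S1 <= S2 + la j * dimD F j by nra.
rewrite {}/S1 {}/S2; move: (jr); rewrite leq_eqVlt => /orP[/eqP rj|{}jr].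
  by rewrite !big_geq ?rj// add0r -rj mulr_ge0.
rewrite big_ltn// [X in _ <= X + _]big_ltn//.
rewrite sum_block_cost_upd//.
have -> : block_cost (flag_upd F j W) j.+1
    = block_cost F j.+1 + lt j.+1 * dimD F j.
  rewrite /block_cost /dimD /= (updE j.+1); last by rewrite neq_ltn ltnSn orbT.
  by rewrite flag_upd_id F0; ring.
have := ler_wpM2r dj (ltla jr); lra.
Qed.

Lemma tail_cost_shift j F : (0 < j < r)%N ->
  tail_cost j (la j) (flag_upd F j.-1 (F j)) = tail_cost j.+1 (lt j.+1) F.
Proof.
move=> /andP[j0 jr]; rewrite /tail_cost /dimD flag_upd_id flag_upd_neq; last by lia.
rewrite !subrr !mulr0 !add0r /= big_ltn//; congr (_ + _).
  rewrite /block_cost /dimD flag_upd_neq; last by lia.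
  by rewrite [flag_upd _ _ _ _]flag_upd_neq//; lia.
by rewrite sum_block_cost_upd//; lia.
Qed.

Lemma flag_tail_shift j F W : (0 < j < r)%N -> (W <= V j)%VS ->
  flag_tail j.+1 W F -> flag_tail j W (flag_upd F j.-1 W).
Proof.
move=> /andP[j0 jr] WV [F0 FV]; split=> [|i ij]; first by rewrite /flag_upd eqxx.
rewrite /flag_upd (_ : (i == j.-1) = false); last by apply/negbTE; lia.
have [->|inj] := eqVneq i j; first by rewrite eqxx; rewrite /= in F0; rewrite F0.
rewrite (_ : (i.-1 == j.-1) = false); last by apply/negbTE; lia.
by apply: FV; lia.
Qed.

End FlagCost.

(** Scales of a block are reached from its bottom [b] by steps of ratio between [2]
    and [4]. *)
Lemma previous_scale (n b T : nat) : (0 < b)%N -> (2 * b <= n <= T)%N ->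
  exists p : nat, [/\ (2 * p <= n <= 4 * p)%N, (b <= p)%N, (0 < p < n)%N &
    p = b \/ (2 * b <= p <= T)%N].
Proof.
move=> b0 bn; exists (if (n < 4 * b)%N then b else (n./2)).
by case: ifP => H; split; lia.
Qed.

(** * Induction over subspaces and scales *)

Section FlagInduction.
Variables (R : realType) (k r : nat) (V : nat -> {vspace 'rV[rat]_k}).
Variables (h : nat -> {vspace 'rV[rat]_k} -> R) (a t : nat -> nat).
Variables (q g K hmax : R) (M : nat -> {vspace 'rV[rat]_k} -> 'rV[rat]_k -> R).
Implicit Types (W : {vspace 'rV[rat]_k}) (F : nat -> {vspace 'rV[rat]_k}).
Let la j : R := ln (a j)%:R.
Let lt j : R := ln (t j)%:R.
Notation tailc := (tail_cost r h la lt).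
Notation tail := (flag_tail r V).
Hypothesis q0 : 0 < q.
Hypothesis g01 : 0 <= g < 1.
Hypothesis K0 : 0 <= K.
Hypothesis hmax0 : 0 <= hmax.
Hypothesis V_mono : forall j, (j < r)%N -> (V j <= V j.+1)%VS.
Hypothesis h_le : forall j W, (1 <= j <= r)%N -> h j W <= hmax.
Hypothesis a_gt0 : forall j, (1 <= j <= r)%N -> (0 < a j)%N.
Hypothesis at_le : forall j, (1 <= j <= r)%N -> (2 * a j <= t j)%N.
Hypothesis ta_le : forall j, (1 <= j < r)%N -> (t j.+1 <= a j)%N.
Hypothesis M_gap : forall j W s, (1 <= j < r)%N -> M (a j) W s = M (t j.+1) W s.
Hypothesis M_le1 : forall W s, M (a r) W s <= 1.
Hypothesis M_block : forall j n n' W (al be : R), (1 <= j <= r)%N -> (W <= V j)%VS ->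
  (a j <= n)%N -> (2 * n <= n' <= 4 * n)%N -> (n' <= t j)%N -> 0 <= be ->
  (forall s, M n W s <= al) ->
  (forall v s, v \in V j -> v \notin W -> M n (W + <[v]>)%VS s <= be) ->
  forall s, M n' W s
    <= expR (- q * h j W * (ln n'%:R - ln n%:R))
         * (if W == V j then 1 else g) * al
       + K * n%:R `^ (- q) * be.

(** The solution [B] of [g * B + K * exp (q * hmax * ln 4) <= B] used for the
    induction in [M_in_block]. *)
Definition flag_const : R := 1 + K * expR (q * hmax * ln 4) / (1 - g).

Lemma flag_const_ge1 : 1 <= flag_const.
Proof.
have /andP[g0 g1] := g01.
by rewrite lerDl !mulr_ge0 ?expR_ge0// invr_ge0 subr_ge0 ltW.
Qed.

(** Within a block, by induction on the codimension of [W] in [V j] and then on the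
    scale.  The bound is stated for every lower bound [x] of the costs, which
    avoids minimizing over the infinite set of flags.  The factor [g < 1] gained
    at each step absorbs the contribution of the larger subspaces [W + <v>],
    which already satisfy a bound with the smaller constant
    [flag_const ^+ e.-1]. *)
Lemma M_in_block j (C : R) : (1 <= j <= r)%N -> 0 <= C ->
  (forall W s x, (W <= V j)%VS ->
     (forall F, tail j W F -> x <= tailc j (la j) F) ->
     M (a j) W s <= C * expR (- q * x)) ->
  forall e W, (W <= V j)%VS -> (\dim (V j) - \dim W)%N = e ->
  forall n, n = a j \/ (2 * a j <= n <= t j)%N -> forall s x,
    (forall F, tail j W F -> x <= tailc j (ln n%:R) F) ->
    M n W s <= C * flag_const ^+ e * expR (- q * x).
Proof.
move=> jr C0 M0; have B1 := flag_const_ge1; set B := flag_const in B1 *.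
have /andP[g0 g1] := g01.
have B0 : 0 <= B := le_trans ler01 B1.
elim/ltn_ind => e IHe W WV dW; elim/ltn_ind => n IHn nP s x xF.
have [|n_a] := eqVneq n (a j).
  move=> na; rewrite na in xF *; apply: le_trans (M0 W s x WV xF) _.
  by rewrite ler_wpM2r ?expR_ge0// ler_peMr// exprn_ege1.
case: nP => [/eqP|ant]; first by rewrite (negbTE n_a).
have aj0 := a_gt0 jr; have nt : (n <= t j)%N by case/andP: ant.
have [p [pnp ap /andP[p0 pn] pC]] := previous_scale aj0 ant.
have p0' : 0 < p%:R :> R by rewrite ltr0n.
set lp : R := ln p%:R; set d : R := ln n%:R - lp.
have d0 : 0 <= d by rewrite subr_ge0 ler_ln ?posrE ?ltr0n ?ler_nat ?(ltnW pn)// (leq_trans p0)// ltnW.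
have lp0 : 0 <= lp by rewrite ln_ge0// ler1n.
have hd : h j W * d <= hmax * ln 4.
  apply: (@le_trans _ _ (hmax * d)); first by rewrite ler_wpM2r// h_le.
  rewrite ler_wpM2l// lerBlDr -lnM ?posrE//.
  rewrite -natrM ler_ln ?posrE ?ltr0n ?ler_nat ?muln_gt0 ?(leq_trans p0 (ltnW pn))//.
  by case/andP: pnp.
(* lower bounds for the costs at scale [n] become lower bounds at scale [p] *)
have xF' F : tail j W F -> x - h j W * d <= tailc j lp F.
  move=> FT; rewrite lerBlDr.
  have [|||lj|F' F'T] := @tail_cost_slope R k r V h la lt j lp (ln n%:R) F W jr FT.
  - by rewrite ln_ge0// ler1n.
  - by rewrite ler_ln ?posrE ?ltr0n ?ler_nat.
  - by rewrite -subr_ge0.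
  - have jr' : (1 <= j < r)%N by case/andP: jr => ->.
    rewrite ler_ln ?posrE ?ltr0n ?ler_nat ?ta_le//.
    by apply: leq_trans (at_le _) => //; rewrite muln_gt0 a_gt0.
  - exact: le_trans (xF _ F'T).
set E := expR (- q * x).
have Ed : expR (- q * (x - h j W * d)) = E * expR (q * (h j W * d)).
  by rewrite /E -expRD; congr expR; ring.
have al_bd s' : M p W s' <= C * B ^+ e * (E * expR (q * (h j W * d))).
  by rewrite -Ed; exact: IHn.
pose be : R := if W == V j then 0 else
  C * B ^+ e.-1 * (E * expR (q * (h j W * d)) * p%:R `^ q).
have be_bd v s' : v \in V j -> v \notin W -> M p (W + <[v]>)%VS s' <= be.
  move=> vV vW; rewrite /be; case: eqP => [WE|_]; first by rewrite WE vV in vW.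
  have WW' : (W <= W + <[v]>)%VS by exact: addvSl.
  have WV' : (W + <[v]> <= V j)%VS by rewrite subv_add WV -memvE.
  have dimW' : \dim (W + <[v]>) = (\dim W).+1.
    have v0 : v != 0 by apply: contraNneq vW => ->; exact: mem0v.
    rewrite dimv_disjoint_sum ?dim_vline ?v0 ?addn1//.
    apply/eqP; rewrite -subv0; apply/subvP => w; rewrite memv_cap memv0.
    move=> /andP[wW /vlineP[c wE]]; move: wW; rewrite wE rpredZeq (negbTE vW) orbF.
    by move=> /eqP->; rewrite scale0r.
  have dimV' := dimvS WV'.
  have -> : E * expR (q * (h j W * d)) * p%:R `^ q
     = expR (- q * (x - h j W * d - lp)).
    rewrite /E /powR gt_eqF// -!expRD; congr expR; rewrite /lp; ring.
  have e1 : (\dim (V j) - \dim (W + <[v]>))%N = e.-1 by rewrite -dW dimW' subnS.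
  have e1e : (e.-1 < e)%N.
    by rewrite prednK// -dW subn_gt0 -dimW'.
  apply: (IHe _ e1e _ WV' e1 p pC) => F FT.
  have j0 : (0 < j)%N by case/andP: jr.
  have [FT' cE] := @tail_cost_first R k r V h la lt j lp F W _ j0 FT WW'.
  have := xF' _ FT'; rewrite cE dimW' -natr1 -/lp; lra.
have E0 : 0 < E by exact: expR_gt0.
have be0 : 0 <= be.
  rewrite /be; case: ifP => // _.
  by rewrite !mulr_ge0 ?exprn_ge0 ?expR_ge0 ?powR_ge0.
have := M_block jr WV ap pnp nt be0 al_bd be_bd s.
rewrite -/lp -/d => /le_trans; apply.
have ee : expR (- q * h j W * d) * expR (q * (h j W * d)) = 1.
  rewrite -expRD -[RHS]expR0; congr expR; ring.
have -> : expR (- q * h j W * d) * (if W == V j then 1 else g)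
   * (C * B ^+ e * (E * expR (q * (h j W * d))))
   = (if W == V j then 1 else g) * (C * B ^+ e * E).
  by rewrite -[RHS]mul1r -ee; ring.
rewrite /be; case: eqP => [_|/eqP WE]; first by rewrite mulr0 addr0 mul1r.
have e0 : (0 < e)%N.
  by rewrite -dW subn_gt0 ltnNge; apply: contra WE => H; rewrite eqEdim WV.
have pq : p%:R `^ (- q) * p%:R `^ q = 1.
  by rewrite -powRD ?(gt_eqF p0') ?implybT// addNr powRr0.
have -> : K * p%:R `^ (- q) * (C * B ^+ e.-1 * (E * expR (q * (h j W * d)) * p%:R `^ q))
   = C * B ^+ e.-1 * E * (K * expR (q * (h j W * d))).
  transitivity (p%:R `^ (- q) * p%:R `^ q
    * (C * B ^+ e.-1 * E * (K * expR (q * (h j W * d))))); last by rewrite pq mul1r.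
  move: (p%:R `^ (- q)) (p%:R `^ q) (B ^+ e.-1) (expR (q * _)) => P1 P2 P3 P4.
  ring.
have -> : B ^+ e = B ^+ e.-1 * B by rewrite -exprSr prednK.
set Z := C * B ^+ e.-1 * E.
have Z0 : 0 <= Z by rewrite !mulr_ge0 ?exprn_ge0// ltW.
have -> : g * (C * (B ^+ e.-1 * B) * E) + Z * (K * expR (q * (h j W * d)))
   = Z * (g * B + K * expR (q * (h j W * d))) by rewrite /Z; ring.
have -> : C * (B ^+ e.-1 * B) * E = Z * B by rewrite /Z; ring.
rewrite ler_wpM2l//.
have K2 : K * expR (q * (h j W * d)) <= K * expR (q * hmax * ln 4).
  by rewrite ler_wpM2l// ler_expR -mulrA ler_wpM2l// ltW.
suff : K * expR (q * hmax * ln 4) <= (1 - g) * B by lra.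
rewrite /B /flag_const mulrDr mulr1 mulrCA divff ?mulr1; last by rewrite subr_eq0 gt_eqF.
by rewrite lerDr subr_ge0 ltW.
Qed.

(** The top of block [j + 1] and the bottom of block [j] see the same elements, so
    the bounds for successive blocks can be chained, from the lowest block up. *)
Lemma M_blocks i : (i < r)%N -> let j := (r - i)%N in
  forall W s x, (W <= V j)%VS ->
    (forall F, tail j W F -> x <= tailc j (lt j) F) ->
    M (t j) W s <= flag_const ^+ (k * i.+1) * expR (- q * x).
Proof.
have B1 := flag_const_ge1.
have codim_le j W : (\dim (V j) - \dim W <= k)%N.
  by apply: leq_trans (leq_subr _ _) _; rewrite (leq_trans (dimvS (subvf _)))// dimvf /dim/= mul1n.
have block j (C : R) : (1 <= j <= r)%N -> 0 <= C ->
  (forall W s x, (W <= V j)%VS ->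
     (forall F, tail j W F -> x <= tailc j (la j) F) ->
     M (a j) W s <= C * expR (- q * x)) ->
  forall W s x, (W <= V j)%VS ->
    (forall F, tail j W F -> x <= tailc j (lt j) F) ->
    M (t j) W s <= C * flag_const ^+ k * expR (- q * x).
  move=> jr C0 M0 W s x WV xF.
  have nP : t j = a j \/ (2 * a j <= t j <= t j)%N by right; rewrite at_le// leqnn.
  have H := @M_in_block j C jr C0 M0 _ W WV erefl (t j) nP s x xF.
  apply: le_trans H _.
  by rewrite ler_wpM2r ?expR_ge0// ler_wpM2l// ler_weXn2l// codim_le.
elim: i => [|i IH] ir j W s x WV xF.
  have jr : (1 <= j <= r)%N by lia.
  rewrite muln1 -[X in X * _]mul1r; apply: (@block j) => // {}W {}s {}x {}WV {}xF.
  rewrite mul1r; apply: (@le_trans _ _ 1).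
    by rewrite (_ : a j = a r) ?M_le1// /j subn0.
  suff x0 : x <= 0 by rewrite -[leLHS]expR0 ler_expR mulNr oppr_ge0 mulr_ge0_le0// ltW.
  apply: le_trans (xF (fun l => if l == j then W else W) _) _.
    split=> [|l jl]; first by rewrite if_same.
    rewrite !if_same; split=> //; rewrite (_ : l = j)//; lia.
  rewrite /tail_cost /dimD !if_same !subrr !mulr0 !add0r big_geq//.
  by rewrite /j subn0.
have jr : (1 <= j < r)%N by lia.
have j1 : j.+1 = (r - i)%N by rewrite /j; lia.
rewrite [(k * _)%N]mulnS addnC exprD; apply: (@block j) => //; first by lia.
  by rewrite exprn_ge0// (le_trans ler01).
move=> {}W {}s {}x {}WV {}xF; rewrite M_gap// j1.
have jltr : (j < r)%N by case/andP: jr.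
apply: (IH (ltnW ir)); rewrite -j1; first exact: subv_trans WV (V_mono _).
move=> F FT.
have Fj : F j = W by case: FT.
apply: le_trans (xF _ (flag_tail_shift jr WV FT)) _.
by rewrite -[in X in flag_upd _ _ X]Fj tail_cost_shift.
Qed.

Lemma M_top s x : (0 < r)%N -> 
    (forall F, tail 1%N (V 0%N) F -> x <= tailc 1%N (lt 1%N) F) ->
    M (t 1%N) (V 0%N) s <= flag_const ^+ (k * r) * expR (- q * x).
Proof.
move=> r0 xF; have := @M_blocks r.-1; rewrite prednK// => /(_ (leqnn _)) /=.
rewrite (_ : (r - r.-1)%N = 1%N); last by lia.
by apply => //; apply: V_mono.
Qed.

End FlagInduction.

(** * The law of the random set *)

Section RandomSetLaw.
Variables (R : realType) (dT : measure_display) (T : measurableType dT).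
Variables (P : probability T R) (A : T -> set nat).
Hypothesis HA : log_random_set P A.

Definition members (s : seq nat) (w : T) : seq nat := [seq b <- s | `[< A w b >]].

Let E b : set T := [set w | A w b].
Let ES (S : {fset nat}) : set T := \bigcap_(m in [set` S]) E m.
Let ev (s : seq nat) (Q : pred (seq nat)) : set T := [set w | Q (members s w)].

Lemma ev_cons b s Q :
  ev (b :: s) Q = (E b `&` ev s (fun B => Q (b :: B))) `|` (ev s Q `\` E b).
Proof.
apply/seteqP; split=> w; rewrite /ev /E /members /=.
  by case: asboolP => Ab Qw; [left|right].
by case=> -[]; case: asboolP.
Qed.

Lemma measurable_members (s : seq nat) (Q : pred (seq nat)) : (forall b, b \in s -> (0 < b)%N) ->
  measurable [set w | Q (members s w)].
Proof.
rewrite -/(ev s Q); elim: s Q => [|b s IH] Q s0.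
  have [Q0|Q0] := boolP (Q [::]).
    by rewrite (_ : ev _ _ = setT) //; apply/seteqP; split.
  by rewrite (_ : ev _ _ = set0) //; apply/seteqP; split=> // w; apply/negP.
have Eb : measurable (E b) by apply: (lrs_meas HA); rewrite s0// mem_head.
have IH' Q' : measurable (ev s Q') by apply: IH => x xs; rewrite s0// inE xs orbT.
by rewrite ev_cons; apply: measurableU; [apply: measurableI|apply: measurableD].
Qed.

Lemma ES_U1 b (S : {fset nat}) : ES (b |` S)%fset = E b `&` ES S.
Proof.
apply/seteqP; split=> w.
  move=> H; split; first by apply: H; rewrite /= !inE eqxx.
  by move=> m /= mS; apply: H; rewrite /= !inE mS orbT.
by move=> [Eb H] m /=; rewrite !inE => /orP[/eqP->//|]; apply: H.
Qed.

(** Prescribing in addition that the elements of [S] belong to the set lets the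
    induction split on the membership of the head of [s], the case of
    non-membership being obtained by subtraction. *)
Lemma prob_ES_members (s : seq nat) (S : {fset nat}) (Q : pred (seq nat)) : uniq s ->
  (forall b, b \in s -> (0 < b)%N) -> (forall b, b \in S -> (0 < b)%N) ->
  (forall b, b \in s -> b \notin S) ->
  P (ES S `&` ev s Q)
  = ((\prod_(m <- S) m%:R^-1) * sublistE s (fun B => (Q B)%:R))%:E.
Proof.
have mE m : (0 < m)%N -> measurable (E m) by exact: (lrs_meas HA).
have mES S' : (forall b, b \in S' -> (0 < b)%N) -> measurable (ES S').
  move=> S'0; rewrite /ES bigcap_fset.
  rewrite big_seq; apply: bigsetI_measurable => m mS'; exact: mE (S'0 m mS').
elim: s S Q => [|b s IH] S Q us s0 S0 sS.
  have PES : P (ES S) = (\prod_(m <- S) m%:R^-1)%:E.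
    rewrite (lrs_indep HA)// big_seq.
    under eq_bigr => m mS do rewrite (lrs_prob HA (S0 m mS)).
    by rewrite -big_seq prodEFin.
  have [Q0|Q0] := boolP (Q [::]).
    rewrite (_ : ev _ _ = setT) ?setIT /= ?Q0 ?mulr1//.
    by apply/seteqP; split.
  rewrite (_ : ev _ _ = set0) ?setI0 ?measure0 /= ?(negbTE Q0) ?mulr0//.
  by apply/seteqP; split=> // w; apply/negP.
have b0 : (0 < b)%N by rewrite s0// mem_head.
have s0' x : x \in s -> (0 < x)%N by move=> xs; rewrite s0// inE xs orbT.
have bS : b \notin S by rewrite sS// mem_head.
move: us => /= /andP[bs us].
have S1 x : x \in (b |` S)%fset -> (0 < x)%N.
  by rewrite !inE => /orP[/eqP->//|/S0].
have sS1 x : x \in s -> x \notin (b |` S)%fset.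
  move=> xs; rewrite !inE negb_or sS ?inE ?xs ?orbT// andbT.
  by apply: contraNneq bs => <-.
have IH1 Q' := IH (b |` S)%fset Q' us s0' S1 sS1.
have IH0 := IH S Q us s0' S0 (fun x xs => sS x (mem_behead (s := b :: s) xs)).
have mev Q' : measurable (ev s Q') by exact: measurable_members.
rewrite ev_cons setIUr measureU; last 3 first.
- by apply: measurableI; [exact: mES|apply: measurableI => //; exact: mE].
- by apply: measurableI; [exact: mES|apply: measurableD => //; exact: mE].
- by apply/seteqP; split=> // w [[_ [Ebw _]] [_ [_ nEb]]].
have E1 Q' : P (ES S `&` (E b `&` ev s Q')) = ((\prod_(m <- (b |` S)%fset) m%:R^-1)
    * sublistE s (fun B : seq nat => (Q' B)%:R))%:E.
  by rewrite setIA (setIC (ES S)) -ES_U1; exact: IH1.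
have E2 : P (ES S `&` (ev s Q `\` E b)) = ((\prod_(m <- S) m%:R^-1
    - \prod_(m <- (b |` S)%fset) m%:R^-1) * sublistE s (fun B : seq nat => (Q B)%:R))%:E.
  rewrite setIDA measureD; last 3 first.
  - by apply: measurableI; [exact: mES|].
  - exact: mE.
  - by rewrite ltey_eq fin_num_measure//; apply: measurableI => //; exact: mES.
  transitivity ((\prod_(m <- S) m%:R^-1 * sublistE s (fun B => (Q B)%:R : R))%:E
    - ((\prod_(m <- (b |` S)%fset) m%:R^-1) * sublistE s (fun B => (Q B)%:R : R))%:E)%E.
    congr (_ - _)%E; first exact: IH0.
    by rewrite setIAC (setIC (ES S)) -ES_U1; exact: IH1.
  by rewrite -EFinB -mulrBl.
rewrite [LHS](_ : _ = ((\prod_(m <- (b |` S)%fset) m%:R^-1)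
    * sublistE s (fun B : seq nat => (Q (b :: B))%:R))%:E + ((\prod_(m <- S) m%:R^-1
    - \prod_(m <- (b |` S)%fset) m%:R^-1) * sublistE s (fun B : seq nat => (Q B)%:R))%:E)%E; last first.
  by congr (_ + _)%E; [exact: (E1 (fun B => Q (b :: B)))|exact: E2].
rewrite big_fsetU1// -EFinD /=; congr EFin; ring.
Qed.

Lemma prob_members (s : seq nat) (Q : pred (seq nat)) : uniq s ->
  (forall b, b \in s -> (0 < b)%N) ->
  P [set w | Q (members s w)] = (sublistE s (fun B => (Q B)%:R))%:E.
Proof.
move=> us s0; have := @prob_ES_members s fset0 Q us s0.
rewrite big_seq_fset0 mul1r => <- => [|b|b bs]; rewrite ?inE//.
by congr (P _); apply/seteqP; split=> [w|w []//]; split.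
Qed.

End RandomSetLaw.

(** * Paths and their classes *)

Section Paths.
Variables (R : realType) (k : nat) (Xs : seq 'rV[rat]_k).
Variable nu : nat -> 'rV[rat]_k -> R.
Hypothesis nu_ge0 : forall b x, 0 <= nu b x.
Hypothesis nu_sum : forall b, \sum_(x <- Xs) nu b x = 1.
Notation path := (nat -> 'rV[rat]_k).
Implicit Types (B : seq nat) (psi : path) (g : path -> R).

Definition path_upd psi (b : nat) (x : 'rV[rat]_k) : path :=
  fun c => if c == b then x else psi c.

(** The same expectation as [walkE], for functions of the whole path. *)
Fixpoint pathE B g : R :=
  if B is b :: B' then
    \sum_(x <- Xs) nu b x * pathE B' (fun psi => g (path_upd psi b x))
  else g (fun=> 0).

Definition path_sum B psi : 'rV[rat]_k := \sum_(b <- B) b%:R *: psi b.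

Definition path_supp B psi : Prop :=
  forall b, b \in B -> psi b \in Xs /\ nu b (psi b) != 0.

Lemma path_upd_id psi b x : path_upd psi b x b = x.
Proof. by rewrite /path_upd eqxx. Qed.

Lemma path_upd_neq psi b x c : c != b -> path_upd psi b x c = psi c.
Proof. by rewrite /path_upd => /negbTE ->. Qed.

Lemma path_sum_upd B psi b x : b \notin B ->
  path_sum (b :: B) (path_upd psi b x) = b%:R *: x + path_sum B psi.
Proof.
move=> bB; rewrite /path_sum big_cons path_upd_id; congr (_ + _).
rewrite big_seq [RHS]big_seq; apply: eq_bigr => c cB.
by rewrite path_upd_neq//; apply: contraNneq bB => <-.
Qed.

Lemma path_supp_upd B psi b x : b \notin B -> x \in Xs -> nu b x != 0 ->
  path_supp B psi -> path_supp (b :: B) (path_upd psi b x).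
Proof.
move=> bB xX nx sp c; rewrite inE; have [->|cb] := eqVneq c b.
  by rewrite path_upd_id.
by rewrite /= => cB; rewrite path_upd_neq//; apply: sp.
Qed.

Lemma pathE_walkE B (g : 'rV[rat]_k -> R) : uniq B ->
  pathE B (fun psi => g (path_sum B psi)) = walkE Xs nu B g.
Proof.
elim: B g => [|b B IH] g /=; first by rewrite /path_sum big_nil.
move=> /andP[bB uB]; apply: eq_bigr => x _; congr (_ * _).
rewrite -IH//; congr pathE; apply/funext => psi.
by rewrite path_sum_upd.
Qed.

Lemma pathE_le B g g' : uniq B ->
  (forall psi, path_supp B psi -> g psi <= g' psi) -> pathE B g <= pathE B g'.
Proof.
elim: B g g' => [|b B IH] g g' /=; first by move=> _; apply.
move=> /andP[bB uB] gg'; rewrite big_seq [leRHS]big_seq.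
apply: ler_sum => x xX; have [->|nx] := eqVneq (nu b x) 0; first by rewrite !mul0r.
by rewrite ler_wpM2l// IH// => psi sp; apply: gg'; apply: path_supp_upd.
Qed.

Lemma pathEZ B (a : R) g : pathE B (fun psi => a * g psi) = a * pathE B g.
Proof.
elim: B g => [//|b B IH] g /=; rewrite mulr_sumr; apply: eq_bigr => x _.
by rewrite IH; ring.
Qed.

Lemma pathED B g g' : pathE B (fun psi => g psi + g' psi) = pathE B g + pathE B g'.
Proof.
elim: B g g' => [//|b B IH] g g' /=; rewrite -big_split/=; apply: eq_bigr => x _.
by rewrite IH mulrDr.
Qed.

Lemma pathE0 B : pathE B (fun=> 0) = 0.
Proof.
by elim: B => [//|b B IH] /=; rewrite big1// => x _; rewrite IH mulr0.
Qed.

Lemma pathE_sum B (I : Type) (t : seq I) (g : I -> path -> R) :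
  pathE B (fun psi => \sum_(i <- t) g i psi) = \sum_(i <- t) pathE B (g i).
Proof.
elim: t => [|i t IH].
  by rewrite big_nil -[RHS](pathE0 B); congr pathE; apply/funext => y; rewrite big_nil.
rewrite big_cons -IH -pathED; congr pathE; apply/funext => y.
by rewrite big_cons.
Qed.

Lemma nu_supp_ex b : exists2 x, x \in Xs & nu b x != 0.
Proof.
apply: contrapT => H; have := nu_sum b; rewrite big_seq big1 => [/eqP|x xX].
  by rewrite eq_sym oner_eq0.
by apply/eqP; apply: contrapT => /negP nx; apply: H; exists x.
Qed.

(** If every path can be made good by changing it on [B0], then the good paths have
    mass at least [m0] to the number of elements of [B0]: integrate out the other
    elements, and at each element of [B0] keep one good value. *)
Lemma pathE_lower B (B0 : pred nat) (m0 : R) (Good : path -> Prop) : uniq B ->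
  0 <= m0 <= 1 ->
  (forall b x, b \in B -> B0 b -> x \in Xs -> nu b x != 0 -> m0 <= nu b x) ->
  (forall psi, path_supp B psi -> exists psi', [/\ path_supp B psi',
     forall c, ~~ (B0 c && (c \in B)) -> psi' c = psi c & Good psi']) ->
  m0 ^+ count B0 B <= pathE B (fun psi => (`[< Good psi >])%:R).
Proof.
move=> + /andP[m00 m01]; elim: B Good => [|b B IH] Good /=.
  move=> _ _ HG; have [psi' [_ psiE G]] := HG (fun=> 0) ltac:(by []).
  have -> : (fun=> 0) = psi'.
    by apply/funext => c; rewrite psiE// in_nil andbF.
  by rewrite expr0 asboolT.
move=> /andP[bB uB] Hm0 HG.
have Hm0' b' x : b' \in B -> B0 b' -> x \in Xs -> nu b' x != 0 -> m0 <= nu b' x.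
  by move=> b'B; apply: Hm0; rewrite inE b'B orbT.
(* [psi'] restored to [psi] at [b] agrees with [psi] off [B0] within [B] *)
have back psi x psi' : path_supp B psi -> path_supp (b :: B) psi' ->
    (forall c, ~~ (B0 c && (c \in b :: B)) -> psi' c = path_upd psi b x c) ->
    [/\ path_supp B (path_upd psi' b (psi b)),
      forall c, ~~ (B0 c && (c \in B)) -> path_upd psi' b (psi b) c = psi c &
      path_upd (path_upd psi' b (psi b)) b (psi' b) = psi'].
  move=> sp sp' E; split.
  - move=> c cB; rewrite path_upd_neq; last by apply: contraNneq bB => <-.
    by apply: sp'; rewrite inE cB orbT.
  - move=> c nc; have [->|cb] := eqVneq c b; first by rewrite path_upd_id.
    by rewrite path_upd_neq// E ?path_upd_neq// inE (negbTE cb).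
  - apply/funext => c; have [->|cb] := eqVneq c b; first by rewrite path_upd_id.
    by rewrite !path_upd_neq.
have [B0b|B0b] := boolP (B0 b); last first.
  rewrite add0n; have -> : m0 ^+ count B0 B = \sum_(x <- Xs) nu b x * m0 ^+ count B0 B.
    by rewrite -mulr_suml nu_sum mul1r.
  rewrite big_seq [leRHS]big_seq; apply: ler_sum => x xX.
  have [->|nx] := eqVneq (nu b x) 0; first by rewrite !mul0r.
  rewrite ler_wpM2l//.
  apply: (IH (fun psi => Good (path_upd psi b x)) uB Hm0') => psi sp.
  have [psi' [sp' E G]] := HG _ (path_supp_upd bB xX nx sp).
  have [H1 H2 H3] := back psi x psi' sp sp' E.
  exists (path_upd psi' b (psi b)); split=> //.
  suff -> : x = psi' b by rewrite H3.
  by rewrite E ?path_upd_id// negb_and B0b.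
rewrite add1n exprS.
pose Good' psi := exists x, [/\ x \in Xs, nu b x != 0 & Good (path_upd psi b x)].
have IHG : m0 ^+ count B0 B <= pathE B (fun psi => (`[< Good' psi >])%:R).
  apply: IH => // psi sp; have [x xX nx] := nu_supp_ex b.
  have [psi' [sp' E G]] := HG _ (path_supp_upd bB xX nx sp).
  have [H1 H2 H3] := back psi x psi' sp sp' E.
  have [pX pn] := sp' b (mem_head _ _).
  exists (path_upd psi' b (psi b)); split=> //.
  by exists (psi' b); rewrite H3.
apply: le_trans (ler_wpM2l m00 IHG) _.
under [leRHS]eq_bigr do rewrite -pathEZ.
rewrite -pathE_sum -pathEZ; apply: pathE_le => // psi sp.
have [[x [xX nx G]]|nG] := pselect (Good' psi); last first.
  rewrite (asboolF nG) mulr0; apply: sumr_ge0 => x _.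
  by rewrite mulr_ge0// ler0n.
rewrite asboolT ?mulr1; last by exists x.
rewrite (big_rem x)//= (asboolT G) mulr1.
rewrite (le_trans (Hm0 b x (mem_head _ _) B0b xX nx))// lerDl.
by apply: sumr_ge0 => y _; rewrite mulr_ge0// ler0n.
Qed.

Variable q : R.
Hypothesis q01 : 0 < q < 1.

(** A good path either falls in a class of mass at least [tau], which Markov's
    inequality makes unlikely, or contributes to one of at most [size Ys]
    classes of mass at most [tau]. *)
Lemma good_mass_le_card B (W : {vspace 'rV[rat]_k}) (Good : path -> Prop)
    (Ys : seq (set 'rV[rat]_k)) (tau : R) : uniq B -> 0 < tau ->
  (forall psi, path_supp B psi -> Good psi -> vcoset W (path_sum B psi) \in Ys) ->
  pathE B (fun psi => (`[< Good psi >])%:R)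
    <= (size Ys)%:R * tau + tau `^ (- q) * moment Xs nu q W B 0.
Proof.
move=> uB tau0 GY; have /andP[q0 q1] := q01.
pose K psi := cosetP Xs nu W B (path_sum B psi).
pose low Y psi : R := `[< vcoset W (path_sum B psi) = Y /\ K psi <= tau >]%:R.
apply: (@le_trans _ _ (pathE B (fun psi => \sum_(Y <- Ys) low Y psi
    + tau `^ (- q) * K psi `^ q))).
  apply: pathE_le => // psi sp; have K0 : 0 <= K psi by exact: cosetP_ge0.
  have S0 : 0 <= \sum_(Y <- Ys) low Y psi by apply: sumr_ge0 => Y _; exact: ler0n.
  have T0 : 0 <= tau `^ (- q) * K psi `^ q by rewrite mulr_ge0 ?powR_ge0.
  have [G|nG] := pselect (Good psi); last by rewrite (asboolF nG) addr_ge0.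
  rewrite (asboolT G); have [Kt|tK] := leP (K psi) tau.
    rewrite (le_trans (y := \sum_(Y <- Ys) low Y psi)) ?lerDl//.
    rewrite (big_rem _ (GY _ sp G))/= {1}/low asboolT// lerDl.
    by apply: sumr_ge0 => Y _; exact: ler0n.
  apply: ler_wpDl => //.
  have e : tau `^ (- q) * tau `^ q = 1.
    by rewrite -powRD ?(gt_eqF tau0) ?implybT// addNr powRr0.
  by rewrite /= -[leLHS]e ler_wpM2l ?powR_ge0// ge0_ler_powR ?nnegrE ?(ltW q0) ?(ltW tau0) ?(ltW tK).
rewrite pathED pathE_sum; apply: lerD; last first.
  rewrite pathEZ ler_wpM2l ?powR_ge0//.
  rewrite -[leRHS](pathE_walkE _ uB) le_eqVlt; apply/orP; left; apply/eqP.
  by congr pathE; apply/funext => psi; rewrite addr0.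
have -> : (size Ys)%:R * tau = \sum_(Y <- Ys) tau.
  by rewrite big_const_seq count_predT iter_addr_0 mulr_natl.
apply: ler_sum => Y _.
have [[psi0 [psi0Y K0]]|nY] :=
    pselect (exists psi0, vcoset W (path_sum B psi0) = Y /\ K psi0 <= tau).
  apply: le_trans K0; rewrite /K /cosetP -(pathE_walkE _ uB).
  apply: pathE_le => // psi _; rewrite /low; case: asboolP => [[psiY _]|_]; rewrite ?ler0n//.
  have : vcoset W (path_sum B psi0) (path_sum B psi).
    by rewrite psi0Y -psiY /vcoset /= subrr mem0v.
  by rewrite /vcoset /= => ->.
rewrite (le_trans _ (ltW tau0))// -(pathE0 B); apply: pathE_le => // psi _.
by rewrite /low asboolF// => H; apply: nY; exists psi.
Qed.

End Paths.

(** * Correcting sums modulo a lattice *)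

Section LatticeCorrection.
Variables (k Q : nat) (G : set 'rV[rat]_k).
Hypothesis Q_gt0 : (0 < Q)%N.
Hypothesis G0 : G 0.
Hypothesis GD : forall x y, G x -> G y -> G (x + y).

Lemma G_dvd x n : G (Q%:R *: x) -> (Q %| n)%N -> G (n%:R *: x).
Proof.
move=> Gx /dvdnP[m ->]; elim: m => [|m IH]; first by rewrite mul0n scale0r.
by rewrite mulSn natrD scalerDl; apply: GD.
Qed.

Lemma sum_mod1 (s : seq nat) : all (fun b => b == 1 %[mod Q])%N s ->
  (\sum_(b <- s) b = size s %[mod Q])%N.
Proof.
elim: s => [|b s IH] /=; first by rewrite big_nil.
by move=> /andP[/eqP b1 /IH bs]; rewrite big_cons -modnDm b1 bs modnDm.
Qed.

(** Each [x] of [xs] owns [Q] of the elements of [B0]; [m] of them, between [1] and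
    [Q], are given the value [x] and the others the value [0].  As these elements
    are [1] modulo [Q], the coefficient of [x] becomes divisible by [Q] for the
    right [m]. *)
Lemma correct_residues (xs : seq 'rV[rat]_k) (B0 : seq nat)
    (cs : 'rV[rat]_k -> nat) :
  (forall x, x \in xs -> G (Q%:R *: x)) -> uniq B0 ->
  size B0 = (Q * size xs)%N -> all (fun b => b == 1 %[mod Q])%N B0 ->
  exists phi : nat -> 'rV[rat]_k,
    [/\ forall b, b \in B0 -> phi b \in 0 :: xs,
        forall x, x \in xs -> exists2 b, b \in B0 & phi b = x &
        G (\sum_(x <- xs) (cs x)%:R *: x + path_sum B0 phi)].
Proof.
elim: xs B0 => [|x xs IH] B0 Gxs uB0.
  rewrite muln0 => /size0nil -> _; exists (fun=> 0); split=> //.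
  by rewrite /path_sum !big_nil addr0.
rewrite mulnS => sB0 B01.
pose m := (Q - cs x %% Q)%N.
have mQ : (m <= Q)%N by rewrite leq_subr.
have m0 : (0 < m)%N by rewrite subn_gt0 ltn_mod.
pose B1 := take m B0; pose B2 := take (Q - m) (drop m B0); pose B3 := drop (Q - m) (drop m B0).
have B0E : B0 = B1 ++ B2 ++ B3 by rewrite /B1 /B2 /B3 !cat_take_drop.
have sB1 : size B1 = m.
  by rewrite size_take sB0; case: ltnP => // H; apply/eqP; rewrite eqn_leq H
     (leq_trans mQ) ?leq_addr.
have sB3 : size B3 = (Q * size xs)%N.
  by rewrite /B3 !size_drop sB0 -subnDA subnKC// addKn.
move: uB0 B01; rewrite B0E !cat_uniq !all_cat.
move=> /and3P[uB1 nB1 /and3P[uB2 nB2 uB3]] /and3P[a1 a2 a3].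
have [//|phi [phiX phiS phiG]] := IH B3 _ uB3 sB3 a3.
  by move=> y yxs; apply: Gxs; rewrite inE yxs orbT.
have nB1' b : b \in B2 ++ B3 -> b \notin B1 by move: nB1; rewrite -all_predC => /allP; apply.
have nB2' b : b \in B3 -> b \notin B2 by move: nB2; rewrite -all_predC => /allP; apply.
pose phi' b := if b \in B1 then x else if b \in B2 then 0 else phi b.
have phi'3 b : b \in B3 -> phi' b = phi b.
  by move=> b3; rewrite /phi' (negbTE (nB1' _ _)) ?mem_cat ?b3 ?orbT// (negbTE (nB2' _ b3)).
exists phi'; split.
- move=> b; rewrite !mem_cat => /orP[b1|/orP[b2|b3]].
  + by rewrite /phi' b1 !inE eqxx orbT.
  + by rewrite /phi' (negbTE (nB1' _ _)) ?mem_cat ?b2// mem_head.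
  + by rewrite phi'3//; move: (phiX b b3); rewrite !inE => /orP[->//|->]; rewrite !orbT.
- move=> y; rewrite inE => /orP[/eqP->|yxs].
    have b1 : nth 0%N B1 0 \in B1 by rewrite mem_nth// sB1.
    by exists (nth 0%N B1 0); rewrite ?mem_cat ?b1// /phi' b1.
  have [b b3 bE] := phiS y yxs; exists b; first by rewrite !mem_cat b3 !orbT.
  by rewrite phi'3.
- rewrite big_cons /path_sum !big_cat/=.
  have -> : \sum_(b <- B1) b%:R *: phi' b = (\sum_(b <- B1) b)%:R *: x.
    rewrite natr_sum scaler_suml big_seq [RHS]big_seq; apply: eq_bigr => b b1.
    by rewrite /phi' b1.
  have -> : \sum_(b <- B2) b%:R *: phi' b = 0.
    rewrite big_seq big1// => b b2.
    by rewrite /phi' (negbTE (nB1' _ _)) ?mem_cat ?b2// scaler0.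
  have -> : \sum_(b <- B3) b%:R *: phi' b = path_sum B3 phi.
    by rewrite /path_sum big_seq [RHS]big_seq; apply: eq_bigr => b b3; rewrite phi'3.
  rewrite add0r addrACA -scalerDl -natrD; apply: GD; last exact: phiG.
  apply: G_dvd; first by apply: Gxs; rewrite mem_head.
  have := sum_mod1 a1; rewrite sB1 => e.
  rewrite /dvdn -modnDmr e modnDmr -modnDml /m subnKC ?modnn//.
  by rewrite ltnW// ltn_mod.
Qed.

End LatticeCorrection.

(** Clear the denominators of the coordinates of [x]. *)
Lemma inIntSpan_den (k : nat) (s : seq 'rV[rat]_k) (x : 'rV[rat]_k) :
  x \in << s >>%VS ->
  exists2 Q : nat, (0 < Q)%N & inIntSpan (in_tuple s) (Q%:R *: x).
Proof.
move=> /(coord_span (X := in_tuple s)) xE.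
pose c i : rat := coord (in_tuple s) i x.
have [Q Q0 Qc] : exists2 Q : nat, (0 < Q)%N &
    forall i, exists z : int, Q%:R * c i = z%:~R.
  exists `|(\prod_i denq (c i))%R|%N.
    by rewrite absz_gt0 prodf_seq_neq0; apply/allP => i _; rewrite denq_neq0.
  move=> i; exists (numq (c i) * \prod_(j | j != i) denq (c j)).
  rewrite natr_absz ger0_norm; last by rewrite prodr_ge0.
  rewrite (bigD1 i)//= !intrM numqE; ring.
exists Q => //.
have [a aP] := choice Qc; exists [ffun i => a i].
rewrite {1}xE scaler_sumr; apply: eq_bigr => i _.
by rewrite ffunE scalerA -/(c i) aP scaler_int.
Qed.

Lemma inIntSpan0 (k m : nat) (s : m.-tuple 'rV[rat]_k) : inIntSpan s 0.
Proof.
exists [ffun=> 0]; rewrite big1// => i _; by rewrite ffunE mulr0z.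
Qed.

Lemma inIntSpanD (k m : nat) (s : m.-tuple 'rV[rat]_k) x y :
  inIntSpan s x -> inIntSpan s y -> inIntSpan s (x + y).
Proof.
move=> [a ->] [b ->]; exists [ffun i => a i + b i].
by rewrite -big_split; apply: eq_bigr => i _; rewrite ffunE mulrzDr.
Qed.

Lemma common_multiple (k : nat) (G : set 'rV[rat]_k) (xs : seq 'rV[rat]_k) :
  G 0 -> (forall x y, G x -> G y -> G (x + y)) ->
  (forall x, x \in xs -> exists2 Q : nat, (0 < Q)%N & G (Q%:R *: x)) ->
  exists2 Q : nat, (0 < Q)%N & forall x, x \in xs -> G (Q%:R *: x).
Proof.
move=> G0 GD; elim: xs => [|x xs IH] H; first by exists 1%N.
have [|Q Q0 GQ] := IH; first by move=> y yxs; apply: H; rewrite inE yxs orbT.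
have [Q' Q'0 GQ'] := H x (mem_head _ _).
exists (Q * Q')%N => [|y]; first by rewrite muln_gt0 Q0.
rewrite inE => /orP[/eqP->|yxs]; first exact: (@G_dvd k Q' G G0 GD) (dvdn_mull _ _).
exact: (@G_dvd k Q G G0 GD) (GQ y yxs) (dvdn_mulr _ (dvdnn _)).
Qed.

(** * Points of the cube *)

Section Cube.
Variable k : nat.

Lemma finite_cube : finite_set (@cube k).
Proof.
pose f (b : {ffun 'I_k -> bool}) : 'rV[rat]_k := \row_i (b i)%:R.
apply: (@sub_finite_set _ _ (f @` setT)); last exact: finite_image.
move=> x xc; exists [ffun i => x ord0 i == 1] => //.
apply/rowP => i; rewrite !mxE ffunE.
by case: (xc i) => ->; rewrite ?eqxx// eq_sym oner_eq0.
Qed.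

Definition cube_seq : seq 'rV[rat]_k := fset_set (@cube k).

Lemma mem_cube_seq x : (x \in cube_seq) <-> cube x.
Proof. by rewrite /cube_seq in_fset_set ?inE//; exact: finite_cube. Qed.

Lemma cube_seq_uniq : uniq cube_seq.
Proof. exact: fset_uniq. Qed.

Lemma cube0 : @cube k 0.
Proof. by move=> s; left; rewrite mxE. Qed.

Lemma fsbig_cube (R : realType) (P : set 'rV[rat]_k) (F : 'rV[rat]_k -> R) :
  (forall x, F x != 0 -> cube x) ->
  \sum_(x \in P) F x = \sum_(x <- cube_seq | `[< P x >]) F x.
Proof.
move=> Fc; transitivity (\sum_(x \in P `&` @cube k) F x).
  apply/esym/fsbig_widen; first by move=> x [].
  by move=> x [Px nPc]; apply: contrapT => /eqP/Fc xc; exact: nPc.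
have H : \sum_(x \in P `&` @cube k) F x = \sum_(x <- [seq x <- cube_seq | `[< P x >]]) F x.
  apply: fsbig_fwiden.
  - by move=> x [Px xc] /=; rewrite mem_filter asboolT//=; apply/mem_cube_seq.
  - exact: filter_uniq cube_seq_uniq.
  - move=> x [/= + nPc]; rewrite mem_filter => /andP[/asboolP Px /mem_cube_seq xc].
    by case: nPc.
by rewrite H big_filter.
Qed.

(** Two coordinates that agree on generators agree on their span. *)
Lemma span_cube_separates (s : seq 'rV[rat]_k) (x : 'rV[rat]_k) (i j : 'I_k) :
  x \in << s >>%VS -> x ord0 i <> x ord0 j ->
  exists2 y, y \in s & y ord0 i <> y ord0 j.
Proof.
move=> /(coord_span (X := in_tuple s)) xE xij.
apply: contrapT => H; apply: xij; rewrite xE !summxE.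
apply: eq_bigr => l _; rewrite !mxE; congr (_ * _).
apply: contrapT => ne; apply: H; exists (in_tuple s)`_l => //.
by rewrite mem_nth// size_tuple.
Qed.

End Cube.

(** * Blocks of consecutive integers *)

Section Blocks.
Variables (r : nat) (a t : nat -> nat).
Hypothesis r_gt0 : (0 < r)%N.
Hypothesis at_lt : forall j, (1 <= j <= r)%N -> (a j < t j)%N.
Hypothesis ta_le : forall j, (1 <= j < r)%N -> (t j.+1 <= a j)%N.

Definition in_block (b j : nat) : bool := (a j < b <= t j)%N.
(** The default [1] makes [block_of b] the index of a block for every [b], so that
    [mu (block_of b)] is always a probability measure. *)
Definition block_of (b : nat) : nat := head 1%N [seq j <- iota 1 r | in_block b j].
Definition in_blocks (b : nat) : bool := has (in_block b) (iota 1 r).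

Lemma block_sep i j : (1 <= j < i)%N -> (i <= r)%N -> (t i <= a j)%N.
Proof.
move=> /andP[j0]; elim: i => [//|i IH] /[!ltnS] ji ir.
have ij : (1 <= i < r)%N by rewrite (leq_trans j0 ji).
apply: leq_trans (ta_le ij) _.
move: ji; rewrite leq_eqVlt => /orP[/eqP->//|ji].
apply: leq_trans (IH ji (ltnW ir)); apply/ltnW/at_lt.
by rewrite (leq_trans j0 (ltnW ji)) ltnW.
Qed.

Lemma block_uniq b i j : (1 <= i <= r)%N -> (1 <= j <= r)%N ->
  in_block b i -> in_block b j -> i = j.
Proof.
wlog : i j / (i <= j)%N.
  by move=> H ir jr bi bj; case: (leqP i j) => [|/ltnW] ij; [|apply/esym]; apply: H.
rewrite leq_eqVlt => /orP[/eqP//|ij] /andP[i0 ir] /andP[j0 jr] /andP[ai _] /andP[_ tj].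
have H : (t j <= a i)%N by apply: block_sep jr; rewrite i0.
by have := leq_trans ai (leq_trans tj H); rewrite ltnn.
Qed.

Lemma block_ofP b : (1 <= block_of b <= r)%N.
Proof.
rewrite /block_of; case E : [seq _ <- _ | _] => [|j s] /=; first by rewrite r_gt0.
have : j \in [seq j <- iota 1 r | in_block b j] by rewrite E mem_head.
by rewrite mem_filter mem_iota add1n ltnS => /andP[].
Qed.

Lemma in_blocksP b :
  reflect (exists2 j, (1 <= j <= r)%N & in_block b j) (in_blocks b).
Proof.
apply: (iffP hasP) => -[j jr bj]; exists j => //.
  by move: jr; rewrite mem_iota add1n ltnS.
by rewrite mem_iota add1n ltnS.
Qed.

Lemma block_of_in b j : (1 <= j <= r)%N -> in_block b j ->
  in_blocks b /\ block_of b = j.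
Proof.
move=> jr bj; have bI : in_blocks b by apply/in_blocksP; exists j.
split=> //; rewrite /block_of; case E : [seq _ <- _ | _] => [|i s] /=.
  have : j \in [seq j <- iota 1 r | in_block b j].
    by rewrite mem_filter bj mem_iota add1n ltnS.
  by rewrite E.
have : i \in [seq j <- iota 1 r | in_block b j] by rewrite E mem_head.
rewrite mem_filter mem_iota add1n ltnS => /andP[bi ir].
exact: block_uniq bi bj.
Qed.

Lemma in_blocks_gap b j : (1 <= j < r)%N -> (t j.+1 < b <= a j)%N -> ~~ in_blocks b.
Proof.
move=> /andP[j0 jr] /andP[tb ba]; apply/in_blocksP => -[i /andP[i0 ir] /andP[ai ti]].
have [ij|ji] := leqP i j.
  have H : (a j <= a i)%N.
    move: ij; rewrite leq_eqVlt => /orP[/eqP->//|ij].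
    have H1 : (t j <= a i)%N by apply: block_sep (ltnW jr); rewrite i0.
    by apply: leq_trans H1; apply/ltnW/at_lt; rewrite j0 (ltnW jr).
  by have := leq_trans ai (leq_trans ba H); rewrite ltnn.
have H : (t i <= t j.+1)%N.
  move: ji; rewrite leq_eqVlt => /orP[/eqP->//|ji].
  have H1 : (t i <= a j.+1)%N by apply: block_sep.
  by apply: leq_trans H1 _; apply/ltnW/at_lt.
by have := leq_trans tb (leq_trans ti H); rewrite ltnn.
Qed.

End Blocks.

Definition lower_end (R : realType) (c : nat -> R) (D : R) (j : nat) : nat :=
  Num.truncn (D `^ c j.+1).

Definition upper_end (R : realType) (c : nat -> R) (D theta : R) (j : nat) : nat :=
  Num.truncn (D `^ (c j * (1 - theta))).

Lemma finite_pos_lower (R : realType) (I : eqType) (s : seq I) (f : I -> R) :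
  (forall i, i \in s -> 0 < f i) ->
  exists2 g : R, 0 < g <= 1 & forall i, i \in s -> g <= f i.
Proof.
elim: s => [|i s IH] f0; first by exists 1 => //; rewrite ltr01 lexx.
have [|g /andP[g0 g1] gf] := IH; first by move=> j js; apply: f0; rewrite inE js orbT.
exists (Num.min g (f i)).
  by rewrite lt_min g0 f0 ?mem_head//= ge_min g1.
move=> j; rewrite inE => /orP[/eqP->|js]; first by rewrite ge_min lexx orbT.
by rewrite ge_min gf.
Qed.

Lemma powR_unbounded (R : realType) (X u : R) : 0 < u ->
  exists2 D1 : R, 1 <= D1 & forall D, D1 <= D -> X <= D `^ u.
Proof.
move=> u0; exists (Num.max 1 (Num.max 1 X `^ u^-1)); first by rewrite le_max lexx.
move=> D; rewrite ge_max => /andP[D1 XD].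
have X0 : 0 <= Num.max 1 X :> R by rewrite le_max ler01.
apply: (@le_trans _ _ (Num.max 1 X)); first by rewrite le_max lexx orbT.
have e : (Num.max 1 X `^ u^-1) `^ u = Num.max 1 X.
  by rewrite -powRrM mulVf ?gt_eqF// powRr1.
rewrite -[leLHS]e.
by rewrite ge0_ler_powR ?nnegrE ?powR_ge0 ?(ltW u0)// (le_trans ler01).
Qed.

(** * The mean moment of an entropy system *)

Section SystemMoment.
Variables (R : realType) (k r : nat) (V : nat -> {vspace 'rV[rat]_k}).
Variables (c : nat -> R) (mu : nat -> 'rV[rat]_k -> R) (eps : R).
Hypothesis r_gt0 : (0 < r)%N.
Hypothesis V0E : V 0%N = <[onev k]>%VS.
Hypothesis V_mono : forall j, (j < r)%N -> (V j <= V j.+1)%VS.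
Hypothesis mu_prob : forall j, (1 <= j <= r)%N ->
  is_prob_on ([set x | x \in V j] `&` @cube k) (mu j).
Hypothesis c1E : c 1%N = 1.
Hypothesis c_dec : forall j, (1 <= j <= r)%N -> c j.+1 < c j.
Hypothesis c_pos : 0 < c r.+1.
Hypothesis eps_gt0 : 0 < eps.
Hypothesis e_gap : forall V', proper_subflag r V' V ->
  entropy_e r V c mu + eps <= entropy_e r V' c mu.
Implicit Types (W : {vspace 'rV[rat]_k}) (F : nat -> {vspace 'rV[rat]_k}).

Let Xs := cube_seq k.
Let Etot : R := \sum_(1 <= j < r.+1) c j * (dimq V j)%:R.

Lemma mu_ge0 j x : (1 <= j <= r)%N -> 0 <= mu j x.
Proof. by move=> /mu_prob[]. Qed.

Lemma mu_supp j x : (1 <= j <= r)%N -> mu j x != 0 -> x \in V j /\ cube x.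
Proof. by move=> /mu_prob[_ H _] /H[]. Qed.

Lemma mu_sum j : (1 <= j <= r)%N -> \sum_(x <- Xs) mu j x = 1.
Proof.
move=> jr; have [_ _ <-] := mu_prob jr.
rewrite fsbig_cube; last by move=> x /(mu_supp jr)[].
by apply: eq_bigl => x; apply/esym/asboolT.
Qed.

Lemma entropyH_coset j W : (1 <= j <= r)%N ->
  entropyH (mu j) W = coset_entropy Xs (mu j) W.
Proof.
move=> jr; rewrite /entropyH /coset_entropy; congr (- _).
rewrite fsbig_cube; last first.
  move=> x; apply: contra_neqP => nx; rewrite (_ : mu j x = 0) ?mul0r//.
  by apply: contrapT => /eqP/(mu_supp jr)[].
rewrite -/Xs; under eq_bigl => x do rewrite asboolT//.
apply: eq_bigr => x _; congr (_ * ln _).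
rewrite fsbig_cube; last by move=> y /(mu_supp jr)[].
rewrite -/Xs; apply: eq_bigl => y; rewrite /vcoset /=.
by rewrite asboolb -memvN opprB.
Qed.

Lemma entropyH_full j : (1 <= j <= r)%N -> entropyH (mu j) (V j) = 0.
Proof.
move=> jr; rewrite entropyH_coset// /coset_entropy big1 ?oppr0// => x _.
have [->|nx] := eqVneq (mu j x) 0; first by rewrite mul0r.
rewrite (_ : \sum_(x' <- Xs | _) _ = 1) ?ln1 ?mulr0//.
rewrite -[RHS](mu_sum jr) [RHS](bigID (fun x' => x - x' \in V j))/=.
rewrite [X in _ = _ + X]big1 ?addr0// => y ny.
apply: contrapT => /eqP/(mu_supp jr)[yV _]; have [xV _] := mu_supp jr nx.
by rewrite memvB in ny.
Qed.

(** A bound for all [- ln (mu j x)], hence for all entropies. *)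
Definition log_bound : R := \sum_(1 <= j < r.+1) \sum_(x <- Xs) `|ln (mu j x)|.

Lemma log_bound_ge0 : 0 <= log_bound.
Proof. by apply: sumr_ge0 => j _; apply: sumr_ge0 => x _. Qed.

Lemma le_log_bound j x : (1 <= j <= r)%N -> x \in Xs -> - ln (mu j x) <= log_bound.
Proof.
move=> jr xX; apply: (@le_trans _ _ `|ln (mu j x)|).
  by rewrite -normrN ler_norm.
rewrite /log_bound (bigD1_seq j) ?iota_uniq ?mem_index_iota ?ltnS//=.
rewrite (big_rem x)//= -addrA lerDl addr_ge0// sumr_ge0// => y _.
by rewrite sumr_ge0.
Qed.

Lemma entropyH_itv j W : (1 <= j <= r)%N -> 0 <= entropyH (mu j) W <= log_bound.
Proof.
move=> jr; rewrite entropyH_coset//; apply: coset_entropy_itv.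
- by move=> x; exact: mu_ge0.
- exact: mu_sum.
- by move=> x xX _; exact: le_log_bound.
Qed.

Let L := log_bound.
Let eta : R := eps / (4 * r%:R).
Definition system_q : R := Num.min 2^-1 (eta / (2 * (L ^+ 2 + 1))).
Let q := system_q.

Let r0 : 0 < r%:R :> R. Proof. by rewrite ltr0n. Qed.
Let eta0 : 0 < eta. Proof. by rewrite divr_gt0// mulr_gt0. Qed.
Let L2 : 0 < L ^+ 2 + 1. Proof. by rewrite ltr_wpDl// sqr_ge0. Qed.

Lemma system_q_itv : 0 < q < 1.
Proof.
have q1 : 0 < eta / (2 * (L ^+ 2 + 1)) by exact: divr_gt0 eta0 (mulr_gt0 _ L2).
rewrite /q /system_q lt_min invr_gt0 ltr0n/= q1/=.
by rewrite gt_min (_ : 2^-1 < 1 :> R)// invf_lt1// ltr1n.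
Qed.

Lemma system_q_small : q * L ^+ 2 <= eta / 2.
Proof.
apply: (@le_trans _ _ (eta / (2 * (L ^+ 2 + 1)) * L ^+ 2)).
  by rewrite ler_wpM2r ?sqr_ge0// /q /system_q ge_min lexx orbT.
have -> : eta / (2 * (L ^+ 2 + 1)) * L ^+ 2 = eta / 2 * (L ^+ 2 / (L ^+ 2 + 1)).
  by field; rewrite gt_eqF.
rewrite ler_piMr//; first exact: divr_ge0 (ltW eta0) (ler0n _ _).
by rewrite ler_pdivrMr// mul1r lerDl.
Qed.

(** The entropy lowered by [eta] off the full flag.  The difference is what pays for
    the geometric series over scales; [eta = eps / (4 r)] makes the total loss
    at most [eps / 4]. *)
Definition slack_entropy (j : nat) W : R :=
  if W == V j then 0 else entropyH (mu j) W - eta.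

Section Scale.
Variables (a t : nat -> nat).
Let nu b := mu (block_of r a t b).
Let M := meanM Xs nu q (in_blocks r a t).
Let g : R := expR (- (q * eta * ln 2 / 4)).
Let kap : R := (size Xs)%:R.
Hypothesis a_big : forall j, (1 <= j <= r)%N -> 4 / (q * eta * ln 2) <= (a j)%:R.
Hypothesis at_le : forall j, (1 <= j <= r)%N -> (2 * a j <= t j)%N.
Hypothesis ta_le : forall j, (1 <= j < r)%N -> (t j.+1 <= a j)%N.

Let q0 : 0 < q. Proof. by case/andP: system_q_itv. Qed.
Let ln2 : 0 < ln 2 :> R. Proof. by rewrite ln_gt0// ltr1n. Qed.
Let qe0 : 0 < q * eta * ln 2. Proof. exact: mulr_gt0 (mulr_gt0 q0 eta0) ln2. Qed.

Lemma a_gt0 j : (1 <= j <= r)%N -> (0 < a j)%N.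
Proof.
move=> /a_big; rewrite -(ltr0n R); apply: lt_le_trans.
exact: divr_gt0.
Qed.

Lemma at_lt j : (1 <= j <= r)%N -> (a j < t j)%N.
Proof. by move=> jr; have := at_le jr; have := a_gt0 jr; clear; lia. Qed.

Let nu_ge0 b x : 0 <= nu b x.
Proof. exact/mu_ge0/block_ofP. Qed.

Let nu_sum b : \sum_(x <- Xs) nu b x = 1.
Proof. exact/mu_sum/block_ofP. Qed.

(** [block_bound] in terms of the slack entropy: half of [eta] covers the second
    order term of [coset_power_entropy], and the other half gives the factor [g],
    once [n] is so large that the error [1 / n] in the harmonic sum is
    negligible. *)
Lemma M_block_bound j n n' W (al be : R) : (1 <= j <= r)%N -> (W <= V j)%VS ->
  (a j <= n)%N -> (2 * n <= n' <= 4 * n)%N -> (n' <= t j)%N -> 0 <= be ->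
  (forall s, M n W s <= al) ->
  (forall v s, v \in V j -> v \notin W -> M n (W + <[v]>)%VS s <= be) ->
  forall s, M n' W s
    <= expR (- q * slack_entropy j W * (ln n'%:R - ln n%:R))
         * (if W == V j then 1 else g) * al
       + 3 * kap * expR (3 * kap) * n%:R `^ (- q) * be.
Proof.
move=> jr WV an nn' n't be0 Hal Hbe s.
have n0 : (0 < n)%N := leq_trans (a_gt0 jr) an.
have al0 : 0 <= al by apply: le_trans (Hal s); exact: (meanM_ge0 q _ nu_ge0 nu_sum).
have [l_le nE] : (n' - n <= 3 * n)%N /\ (n + (n' - n))%N = n'.
  by move: nn'; clear; lia.
have nuE b : (n < b <= n + (n' - n))%N -> in_blocks r a t b /\ nu b = mu j.
  rewrite nE => /andP[nb bn'].
  have [|bI bj] := @block_of_in r a t at_lt ta_le b j jr; last by rewrite /nu bj.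
  by rewrite /in_block (leq_ltn_trans an nb) (leq_trans bn').
have := @block_bound R k Xs nu q (in_blocks r a t) nu_ge0 nu_sum system_q_itv
  (mu j) (V j) W n (n' - n) (fun x => mu_ge0 x jr) (mu_sum jr)
  (fun x H => (mu_supp jr H).1) n0 l_le nuE al be be0 Hal Hbe s.
rewrite nE => /le_trans; apply; rewrite lerD2r ler_wpM2r//.
set rho := coset_power _ _ _ _; set H := \sum_(_ < _) _.
have rho1 : 0 <= 1 - rho.
  rewrite subr_ge0; apply: coset_power_le1 => //; [exact: system_q_itv| |exact: mu_sum].
  by move=> x; exact: mu_ge0.
have rho0 : 1 - rho <= 1.
  rewrite gerBl; apply: sumr_ge0 => x _; rewrite mulr_ge0 ?powR_ge0//.
  exact: mu_ge0.
have H0 : 0 <= H by apply: sumr_ge0 => i _; rewrite invr_ge0 ler0n.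
rewrite /slack_entropy; case: eqP => [_|_].
  rewrite mulr0 mul0r expR0 mulr1 -[leRHS]expR0 ler_expR mulNr oppr_le0.
  exact: mulr_ge0.
rewrite -expRD ler_expR.
set h := entropyH _ _; set lam := ln _ - ln _.
have Hlam : lam - n%:R^-1 <= H.
  by have := @sum_inv_ge_ln R n (n' - n) n0; rewrite nE.
have lam2 : ln 2 <= lam.
  rewrite /lam lerBrDr -lnM ?posrE ?ltr0n// -natrM.
  have /andP[nn1 _] := nn'.
  by rewrite ler_ln ?posrE ?ltr0n ?ler_nat ?muln_gt0// (leq_trans _ nn1) ?muln_gt0.
have inv_n : n%:R^-1 <= q * eta * ln 2 / 4.
  rewrite -[leRHS]invrK lef_pV2 ?posrE ?invr_gt0 ?divr_gt0 ?ltr0n//.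
  by rewrite invf_div (le_trans (a_big jr))// ler_nat.
have n10 : 0 <= n%:R^-1 :> R by rewrite invr_ge0 ler0n.
have qh : q * (h - eta / 2) <= 1 - rho.
  apply: (@le_trans _ _ (q * (h - q * L ^+ 2))).
    by rewrite ler_wpM2l ?(ltW q0)// lerD2l lerN2 system_q_small.
  rewrite /h entropyH_coset//; apply: coset_power_entropy => //.
  - exact: system_q_itv.
  - by move=> x; exact: mu_ge0.
  - exact: mu_sum.
  - by move=> x xX _; exact: le_log_bound.
have lam0 : 0 <= lam := le_trans (ltW ln2) lam2.
have e1 : (1 - rho) * (lam - n%:R^-1) <= (1 - rho) * H by rewrite ler_wpM2l.
have e2 : (1 - rho) * n%:R^-1 <= n%:R^-1 by rewrite ler_piMl.
have e3 : q * (h - eta / 2) * lam <= (1 - rho) * lam by rewrite ler_wpM2r.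
have e4 : q * eta * ln 2 <= q * eta * lam.
  by rewrite ler_wpM2l// ltW// mulr_gt0.
rewrite !mulNr -opprD lerN2.
have -> : q * (h - eta) * lam = q * (h - eta / 2) * lam - q * eta * lam / 2.
  by field.
move: e1; rewrite mulrBr => e1; lra.
Qed.

Definition scale_const : R := flag_const q g (3 * kap * expR (3 * kap)) L ^+ (k * r).

Lemma scale_const_ge1 : 1 <= scale_const.
Proof.
apply: exprn_ege1; apply: flag_const_ge1.
- by rewrite expR_ge0 expR_lt1 oppr_lt0 divr_gt0.
- by rewrite !mulr_ge0 ?expR_ge0 ?ler0n.
Qed.

Lemma meanM_top x : (forall F, flag_tail r V 1 (V 0%N) F ->
    x <= \sum_(1 <= j < r.+1)
      block_cost slack_entropy (fun j => ln (a j)%:R) (fun j => ln (t j)%:R) F j) ->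
  M (t 1%N) (V 0%N) 0 <= scale_const * expR (- q * x).
Proof.
move=> xF; apply: (@M_top R k r V slack_entropy a t q g (3 * kap * expR (3 * kap)) L M) => //.
- by rewrite expR_ge0 expR_lt1 oppr_lt0 divr_gt0.
- by rewrite !mulr_ge0 ?expR_ge0 ?ler0n.
- exact: log_bound_ge0.
- move=> j W jr; rewrite /slack_entropy; case: ifP => _; first exact: log_bound_ge0.
  have /andP[_ H] := entropyH_itv W jr; apply: le_trans H.
  by rewrite gerBl ltW.
- exact: a_gt0.
- move=> j W s jr; apply: meanM_skip (ta_le jr) _; first exact: system_q_itv.
  by move=> b tb; apply: in_blocks_gap jr tb => //; exact: at_lt.
- by move=> W s; apply: (meanM_le1 _ nu_ge0 nu_sum system_q_itv).
- exact: M_block_bound.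
- move=> F FT; apply: le_trans (xF F FT) _.
  by rewrite /tail_cost big_ltn.
Qed.

End Scale.

Section CostLowerBound.
Variables (D theta : R).
Let a := lower_end c D.
Let t := upper_end c D theta.
Let la j : R := ln (a j)%:R.
Let lt j : R := ln (t j)%:R.
Hypothesis D_ge1 : 1 <= D.
Hypothesis theta_itv : 0 <= theta <= 2^-1.
Hypothesis theta_small : theta * (r%:R * L) <= eps / 4.
Hypothesis c_gap : forall j, (1 <= j <= r)%N -> c j.+1 <= c j * (1 - theta).

Let D0 : 0 < D. Proof. exact: lt_le_trans ltr01 D_ge1. Qed.
Let lnD0 : 0 <= ln D. Proof. exact: ln_ge0. Qed.

Lemma c_bounds j : (1 <= j <= r.+1)%N -> c r.+1 <= c j <= 1.
Proof.
move=> /andP[j0 jr]; apply/andP; split.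
  have H n : (j + n <= r.+1)%N -> c (j + n)%N <= c j.
    elim: n => [|n IH]; first by rewrite addn0.
    rewrite addnS ltnS => jn; apply: le_trans (IH (leqW jn)).
    by apply/ltW/c_dec; rewrite jn addn_gt0 j0.
  by have := H (r.+1 - j)%N; rewrite subnKC//; apply.
rewrite -c1E; elim: j j0 jr => [//|[_ //|j] IH _ jr].
by apply: le_trans (IH isT (ltnW jr)); apply/ltW/c_dec.
Qed.

Lemma ln_truncn_powR (u : R) : 0 <= u ->
  u * ln D - ln 2 <= ln (Num.truncn (D `^ u))%:R <= u * ln D.
Proof.
move=> u0; set y := D `^ u.
have y1 : 1 <= y by rewrite /y -(powRr0 D) ler_powR.
have y0 : 0 < y := lt_le_trans ltr01 y1.
have /andP[ty yt] := truncn_itv (ltW y0).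
have t1 : (1 <= Num.truncn y)%N by rewrite truncn_gt0.
have t0 : 0 < (Num.truncn y)%:R :> R by rewrite ltr0n.
have <- : ln y = u * ln D by rewrite /y ln_powR.
rewrite ler_ln// ty andbT lerBlDr -lnM ?posrE// ler_ln ?posrE// ?mulr_gt0//.
apply: le_trans (ltW yt) _; rewrite -natrM ler_nat; clear -t1; lia.
Qed.

(** The block [j] occupies [c_j (1 - theta) - c_(j+1)] of the logarithmic scale,
    which is [theta c_(j+1)] short of [(1 - theta) (c_j - c_(j+1))]; the loss only
    matters where [F j] is not [V j], since the entropy vanishes on [V j]. *)
Lemma block_cost_lower F j : (1 <= j <= r)%N ->
  (F j.-1 <= F j)%VS -> 
  ln D * ((1 - theta) * (c j * dimD R F j + (c j - c j.+1) * entropyH (mu j) (F j))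
    - (theta * L + eta) * (F j != V j)%:R) - (k%:R + L) * ln 2
  <= block_cost slack_entropy la lt F j.
Proof.
move=> jr Fj; have /andP[th0 th1] := theta_itv.
have /andP[cj0 cj1] := @c_bounds j ltac:(clear -jr; lia).
have /andP[cj0' cj1'] := @c_bounds j.+1 ltac:(clear -jr; lia).
have cjp : 0 <= c j by rewrite (le_trans (ltW c_pos)).
have cjp' : 0 <= c j.+1 by rewrite (le_trans (ltW c_pos)).
have ct0 : 0 <= c j * (1 - theta) by rewrite mulr_ge0// subr_ge0; lra.
have /andP[lt1 lt2] := ln_truncn_powR ct0.
have /andP[la1 la2] := ln_truncn_powR cjp'.
rewrite -/(upper_end c D theta j) -/(lt j) in lt1 lt2.
rewrite -/(lower_end c D j) -/(la j) in la1 la2.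
have la0 : 0 <= la j.
  by rewrite /la ln_ge0// ler1n truncn_gt0 -(powRr0 D) ler_powR.
have /andP[H0 HL] := entropyH_itv (F j) jr.
have dF0 : 0 <= dimD R F j by rewrite subr_ge0 ler_nat dimvS.
have dFk : dimD R F j <= k%:R.
  rewrite /dimD lerBlDr -natrD ler_nat (leq_trans _ (leq_addr _ _))//.
  by rewrite (leq_trans (dimvS (subvf _)))// dimvf /dim/= mul1n.
have ln20 : 0 <= ln 2 :> R by rewrite ln_ge0// ler1n.
rewrite /block_cost.
have e1 : (c j * (1 - theta) * ln D - ln 2) * dimD R F j <= lt j * dimD R F j.
  by rewrite ler_wpM2r.
have e2 : ln 2 * dimD R F j <= ln 2 * k%:R by rewrite ler_wpM2l.
rewrite /slack_entropy; case: eqP => [->|_].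
  rewrite entropyH_full// mulr0 mul0r !addr0 mulr0 subr0.
  have : 0 <= L * ln 2 by rewrite mulr_ge0// log_bound_ge0.
  move: e1 e2; lra.
have e3 : theta * c j.+1 * entropyH (mu j) (F j) <= theta * L.
  by rewrite -mulrA ler_wpM2l// (le_trans _ HL)// ler_piMl.
have e3' : ln D * (theta * c j.+1 * entropyH (mu j) (F j)) <= ln D * (theta * L).
  by rewrite ler_wpM2l.
rewrite mulr1 mulrBl.
have e4 : entropyH (mu j) (F j) * ((c j * (1 - theta) - c j.+1) * ln D - ln 2)
   <= entropyH (mu j) (F j) * (lt j - la j).
  rewrite ler_wpM2l//; lra.
have e5 : eta * (lt j - la j) <= eta * ln D.
  rewrite ler_wpM2l ?(ltW eta0)//.
  have : c j * (1 - theta) * ln D <= 1 * ln D.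
    rewrite ler_wpM2r//; nra.
  lra.
have e6 : entropyH (mu j) (F j) * ln 2 <= L * ln 2 by rewrite ler_wpM2r.
nra.
Qed.

(** For the full flag there is no loss.  A proper subflag loses at most
    [theta r L + r eta <= eps / 2], no more than the excess [(1 - theta) eps] of its
    entropy. *)
Lemma total_cost_lower F : flag_tail r V 1 (V 0%N) F ->
  (1 - theta) * Etot * ln D - r%:R * (k%:R + L) * ln 2
  <= \sum_(1 <= j < r.+1) block_cost slack_entropy la lt F j.
Proof.
move=> [F0 FV]; have /andP[th0 th1] := theta_itv.
have bc j : (1 <= j < r.+1)%N -> 
  ln D * ((1 - theta) * (c j * dimD R F j + (c j - c j.+1) * entropyH (mu j) (F j))
    - (theta * L + eta) * (F j != V j)%:R) - (k%:R + L) * ln 2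
  <= block_cost slack_entropy la lt F j.
  by rewrite ltnS => jr; apply: block_cost_lower => //; case: (FV j jr).
apply: le_trans (ler_sum_nat bc).
have dimE j : (1 <= j < r.+1)%N -> dimD R F j = (dimq F j)%:R.
  by rewrite ltnS => jr; rewrite /dimD /dimq natrB// dimvS//; case: (FV j jr).
pose N : R := \sum_(1 <= j < r.+1) (F j != V j)%:R.
have EE : \sum_(1 <= j < r.+1) (ln D * ((1 - theta)
      * (c j * dimD R F j + (c j - c j.+1) * entropyH (mu j) (F j))
    - (theta * L + eta) * (F j != V j)%:R) - (k%:R + L) * ln 2)
  = ln D * ((1 - theta) * entropy_e r F c mu - (theta * L + eta) * N)
    - r%:R * ((k%:R + L) * ln 2).
  rewrite /entropy_e -big_split/=.
  have -> (x : R) : r%:R * x = \sum_(1 <= j < r.+1) x.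
    by rewrite sumr_const_nat subn1 mulr_natl.
  rewrite /N !mulr_sumr -!sumrB mulr_sumr -sumrB.
  by apply: eq_big_nat => j jr; rewrite dimE// [X in (1 - theta) * X]addrC.
rewrite EE mulrA.
have eV : entropy_e r V c mu = Etot.
  rewrite /entropy_e big_nat big1 ?add0r// => j; rewrite ltnS => jr.
  by rewrite entropyH_full// mulr0.
rewrite lerD2r [leLHS]mulrC ler_wpM2l//.
have [FE|nF] := pselect (forall j, (1 <= j <= r)%N -> F j = V j).
  have FE' j : (j <= r)%N -> F j = V j by case: j => [//|j] jr; rewrite FE.
  have -> : entropy_e r F c mu = Etot.
    rewrite -eV /entropy_e; congr (_ + _); apply: eq_big_nat => j; rewrite ltnS => /andP[j0 jr].
      by rewrite FE'.
    by rewrite /dimq !FE'// (leq_trans (leq_pred _)).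
  have -> : N = 0.
    rewrite /N big_nat big1// => j; rewrite ltnS => /andP[j0 jr].
    by rewrite FE' ?eqxx.
  by rewrite mulr0 subr0.
have gapF : Etot + eps <= entropy_e r F c mu.
  rewrite -eV; apply: e_gap; split.
    split=> [|j jr|j jr]; first by rewrite F0.
      by have [] := FV j.+1 ltac:(by []).
    case: j jr => [|j] jr; first by rewrite F0.
    by have [] := FV j.+1 ltac:(by []).
  apply: contrapT => H; apply: nF => j jr; apply: contrapT => ne.
  by apply: H; exists j.
have Nr : N <= r%:R.
  apply: (@le_trans _ _ (\sum_(1 <= j < r.+1) 1)); last by rewrite sumr_const_nat subn1.
  by apply: ler_sum => j _; rewrite lern1 leq_b1.
have L0 := log_bound_ge0; rewrite -/L in L0.
have tL : 0 <= theta * L + eta by rewrite addr_ge0 ?mulr_ge0// ltW.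
have e1 : (theta * L + eta) * N <= (theta * L + eta) * r%:R by rewrite ler_wpM2l.
have e2 : eta * r%:R = eps / 4 by rewrite /eta; field; rewrite gt_eqF.
have e3 : (1 - theta) * (Etot + eps) <= (1 - theta) * entropy_e r F c mu.
  by rewrite ler_wpM2l// subr_ge0; lra.
have e4 : theta * eps <= 2^-1 * eps by rewrite ler_wpM2r// ltW.
have := theta_small; nra.
Qed.

Variable n0 : R.
Hypothesis n0_q : 4 / (q * eta * ln 2) <= n0.
Hypothesis D_gap : forall j, (1 <= j <= r)%N -> 2 <= D `^ (c j * (1 - theta) - c j.+1).
Hypothesis D_big : n0 + 1 <= D `^ (c r.+1).

Lemma lower_scale_big j : (1 <= j <= r)%N -> n0 <= (a j)%:R.
Proof.
move=> jr; have /andP[cj _] := @c_bounds j.+1 ltac:(clear -jr; lia).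
rewrite -(lerD2r 1) natr1; apply: (@le_trans _ _ (D `^ c j.+1)); last first.
  by apply/ltW/truncnS_gt.
by apply: le_trans D_big _; rewrite ler_powR.
Qed.

Lemma scale_ratio j : (1 <= j <= r)%N -> (2 * a j <= t j)%N.
Proof.
move=> jr; rewrite /t /upper_end truncn_ge_nat ?powR_ge0// natrM.
have -> : c j * (1 - theta) = c j * (1 - theta) - c j.+1 + c j.+1 by rewrite subrK.
rewrite powRD ?(gt_eqF D0) ?implybT//.
by apply: ler_pM => //; [exact: D_gap|rewrite truncn_le powR_ge0].
Qed.

Lemma scale_disjoint j : (1 <= j < r)%N -> (t j.+1 <= a j)%N.
Proof.
move=> jr; apply: le_truncn; rewrite ler_powR//.
have /andP[cj _] := @c_bounds j.+1 ltac:(clear -jr; lia).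
have /andP[th0 _] := theta_itv.
by rewrite ler_piMr ?(le_trans (ltW c_pos))// gerBl.
Qed.

Lemma mean_moment_bound :
  meanM Xs (fun b => mu (block_of r a t b)) q (in_blocks r a t) (t 1%N) (V 0%N) 0
  <= scale_const * expR (q * (r%:R * (k%:R + L) * ln 2))
     * D `^ (- (q * ((1 - theta) * Etot))).
Proof.
have a_big j : (1 <= j <= r)%N -> 4 / (q * eta * ln 2) <= (a j)%:R.
  by move=> jr; exact: le_trans n0_q (lower_scale_big jr).
have := @meanM_top a t a_big scale_ratio scale_disjoint _ total_cost_lower.
move=> /le_trans; apply; rewrite -(mulrA scale_const) ler_wpM2l//.
  by apply: le_trans ler01 _; exact: scale_const_ge1.
rewrite /powR (gt_eqF D0) -expRD ler_expR le_eqVlt; apply/orP; left; apply/eqP; ring.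
Qed.

End CostLowerBound.

(** [kappa0] is small against the gaps between the exponents, so that all blocks
    have a length bounded below, and against [eps / (r L)], as
    [total_cost_lower] needs. *)
Lemma kappa_choice : exists kappa0 g0 : R,
  [/\ 0 < kappa0 <= 2^-1, 0 < g0, 
    forall j, (1 <= j <= r)%N -> 2 * kappa0 < c j - c j.+1,
    kappa0 * (r%:R * L) <= eps / 4 &
    forall theta j, 0 <= theta <= kappa0 -> (1 <= j <= r)%N ->
      g0 <= c j * (1 - theta) - c j.+1].
Proof.
have [j|g /andP[g0 g1] gP] := @finite_pos_lower R nat (iota 1 r) (fun j => c j - c j.+1).
  by rewrite mem_iota add1n ltnS => jr; rewrite subr_gt0 c_dec.
have gP' j : (1 <= j <= r)%N -> g <= c j - c j.+1.
  by move=> jr; apply: gP; rewrite mem_iota add1n ltnS.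
have L0 := log_bound_ge0; rewrite -/L in L0.
have rL : 0 <= r%:R * L by rewrite mulr_ge0 ?ler0n.
pose e1 := eps / (4 * (r%:R * L + 1)).
have e10 : 0 < e1 by rewrite divr_gt0// mulr_gt0// ltr_wpDl.
have k0 : 0 < Num.min (g / 4) e1 by rewrite lt_min e10 divr_gt0.
have kg : Num.min (g / 4) e1 <= g / 4 by rewrite ge_min lexx.
exists (Num.min (g / 4) e1), (g / 2); split.
- by rewrite k0/=; lra.
- by rewrite divr_gt0.
- by move=> j /gP' H; lra.
- apply: (@le_trans _ _ (e1 * (r%:R * L))).
    by rewrite ler_wpM2r// ge_min lexx orbT.
  have -> : e1 * (r%:R * L) = eps / 4 * (r%:R * L / (r%:R * L + 1)).
    by rewrite /e1; field; rewrite gt_eqF// ltr_wpDl.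
  by rewrite ler_piMr ?divr_ge0 ?(ltW eps_gt0)// ler_pdivrMr ?ltr_wpDl// mul1r lerDl.
- move=> theta j /andP[th0 thk] jr; have H := gP' j jr.
  have /andP[_ cj1] := @c_bounds j ltac:(clear -jr; lia).
  have : theta * c j <= theta * 1 by rewrite ler_wpM2l.
  lra.
Qed.

End SystemMoment.

(** * Counting classes for a fixed set *)

Section ClassCount.
Variables (R : realType) (k r : nat) (V : nat -> {vspace 'rV[rat]_k}).
Variables (c : nat -> R) (mu : nat -> 'rV[rat]_k -> R) (G : set 'rV[rat]_k).
Variables (kappa D : R) (i : nat).
Let a := lower_end c D.
Let t := upper_end c D (kappa / i%:R).
Let Xs := cube_seq k.
Let nu b := mu (block_of r a t b).
Local Notation L A := (Lset r V c G kappa D i A).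
Local Notation I := (Iset r c kappa D i).

Lemma IblockE j b : Iblock c kappa D i j b <-> in_block a t b j.
Proof.
rewrite /Iblock /in_block /= /a /t /lower_end /upper_end truncn_lt_nat ?powR_ge0//.
by rewrite truncn_ge_nat ?powR_ge0.
Qed.

Lemma IsetE b : I b <-> in_blocks r a t b.
Proof.
split=> [[j jr /IblockE bj]|/in_blocksP[j jr bj]]; first by apply/in_blocksP; exists j.
by exists j => //; apply/IblockE.
Qed.

Lemma Lset_ext A A' : A `&` I = A' `&` I -> L A = L A'.
Proof.
move=> AA'; rewrite /Lset AA'; congr (image _ _).
apply/seteqP; split=> psi [[c1 c2] nd Gp]; split=> //; split=> //.
- by rewrite -AA'.
- move=> j b jr bA' bj; apply: (c2 j) => //.
  have : (A `&` I) b by rewrite AA'; split=> //; exists j.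
  by case.
- by rewrite AA'.
- move=> j b jr bA bj; apply: (c2 j) => //.
  have : (A' `&` I) b by rewrite -AA'; split=> //; exists j.
  by case.
Qed.

Section Elements.
Variable B : seq nat.
Hypothesis B_uniq : uniq B.
Hypothesis B_blocks : forall b, b \in B -> in_blocks r a t b.

Lemma domE : [set` B] `&` I = [set` B].
Proof. by apply/seteqP; split=> [b []//|b bB]; split=> //; apply/IsetE/B_blocks. Qed.

Lemma psi_sumE (psi : nat -> 'rV[rat]_k) : psi_sum [set` B] psi = path_sum B psi.
Proof. by rewrite /psi_sum /path_sum [RHS]fsbig_seq. Qed.

Lemma finite_cube_sums (s : seq nat) :
  finite_set [set path_sum s psi | psi in
    [set psi : nat -> 'rV[rat]_k | forall b, b \in s -> cube (psi b)]].
Proof.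
elim: s => [|b s IH].
  apply: (@sub_finite_set _ _ [set 0]); last exact: finite_set1.
  by move=> x [psi _ <-]; rewrite /path_sum big_nil.
apply: (@sub_finite_set _ _ [set b%:R *: p.1 + p.2 | p in @cube k `*`
    [set path_sum s psi | psi in
    [set psi : nat -> 'rV[rat]_k | forall b, b \in s -> cube (psi b)]]]); last first.
  apply: finite_image; apply: finite_setX => //; exact: finite_cube.
move=> x [psi psic <-]; exists (psi b, path_sum s psi).
  split; first by apply: psic; exact: mem_head.
  by exists psi => // b' b's; apply: psic; rewrite inE b's orbT.
by rewrite /path_sum big_cons.
Qed.

Lemma finite_Lset : finite_set (L [set` B]).
Proof.
apply: (@sub_finite_set _ _ [set vcoset <[onev k]>%VS x | x in
    [set path_sum B psi | psi in
    [set psi : nat -> 'rV[rat]_k | forall b, b \in B -> cube (psi b)]]]); last first.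
  apply: finite_image; exact: finite_cube_sums.
move=> Y [psi [[c1 _] _ _] <-]; rewrite domE psi_sumE.
exists (path_sum B psi) => //; exists psi => // b bB; apply: c1.
by rewrite domE.
Qed.

Hypothesis r_gt0 : (0 < r)%N.
Hypothesis at_lt : forall j, (1 <= j <= r)%N -> (a j < t j)%N.
Hypothesis ta_le : forall j, (1 <= j < r)%N -> (t j.+1 <= a j)%N.
Hypothesis V_sub : forall j, (j <= r)%N -> (V j <= V r)%VS.
Hypothesis mu_ge0 : forall j x, (1 <= j <= r)%N -> 0 <= mu j x.
Hypothesis mu_sum : forall j, (1 <= j <= r)%N -> \sum_(x <- Xs) mu j x = 1.
Hypothesis mu_supp : forall j x, (1 <= j <= r)%N ->
  mu j x != 0 <-> x \in V j /\ cube x.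
Hypothesis V_cube : exists2 s : seq 'rV[rat]_k,
  {in s, forall x, cube x} & V r = << s >>%VS.
Hypothesis V_nondeg : forall s u : 'I_k, (s < u)%N ->
  exists2 x, x \in V r & x ord0 s <> x ord0 u.
Hypothesis G0 : G 0.
Hypothesis GD : forall x y, G x -> G y -> G (x + y).
Variables (q m0 : R) (Q : nat).
Hypothesis q01 : 0 < q < 1.
Hypothesis m0_itv : 0 <= m0 <= 1.
Hypothesis m0_le : forall x, x \in Xs -> mu r x != 0 -> m0 <= mu r x.
Let Xr := [seq x <- Xs | x \in V r].
Hypothesis Q_gt0 : (0 < Q)%N.
Hypothesis GQ : forall x, x \in Xr -> G (Q%:R *: x).
Let spare (b : nat) : bool := in_block a t b r && (b == 1 %[mod Q])%N.
Hypothesis spare_many : (Q * size Xr <= count spare B)%N.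

Let rr : (1 <= r <= r)%N. Proof. by rewrite r_gt0 leqnn. Qed.
Let nu_ge0 b x : 0 <= nu b x. Proof. exact/mu_ge0/block_ofP. Qed.
Let nu_sum b : \sum_(x <- Xs) nu b x = 1. Proof. exact/mu_sum/block_ofP. Qed.

Definition good_path (psi : nat -> 'rV[rat]_k) : Prop :=
  G (path_sum B psi) /\ Defs.nondegenerate [set` B] psi.

Lemma path_supp_V psi b : path_supp Xs nu B psi -> b \in B ->
  [/\ psi b \in V (block_of r a t b), psi b \in V r & cube (psi b)].
Proof.
move=> sp bB; have [_ nz] := sp b bB.
have br := block_ofP a t r_gt0 b.
have [pV pc] := (mu_supp (psi b) br).1 nz; split=> //.
by apply: subvP pV; apply: V_sub; case/andP: br.
Qed.

Lemma good_path_class psi : path_supp Xs nu B psi -> good_path psi ->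
  L [set` B] (vcoset <[onev k]>%VS (path_sum B psi)).
Proof.
move=> sp [Gp nd]; exists psi; last by rewrite domE psi_sumE.
rewrite /= domE psi_sumE; split=> //; split=> [b|j b jr bB /IblockE bj].
  by rewrite domE => bB; have [] := path_supp_V sp bB.
have [] := path_supp_V sp bB; have [_ ->] := block_of_in at_lt ta_le jr bj.
by [].
Qed.

Lemma separating_point (s u : 'I_k) : s <> u ->
  exists2 x, x \in Xr & x ord0 s <> x ord0 u.
Proof.
have [xs xsc VE] := V_cube.
have H (s' u' : 'I_k) : (s' < u')%N -> exists2 x, x \in Xr & x ord0 s' <> x ord0 u'.
  move=> su; have [x xV xsu] := V_nondeg su; rewrite VE in xV.
  have [y ys ysu] := span_cube_separates xV xsu; exists y => //.
  rewrite mem_filter VE memv_span//=; apply/mem_cube_seq; exact: xsc.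
move=> /eqP; rewrite -val_eqE neq_ltn => /orP[/H//|/H[x xX xus]].
by exists x => // e; apply: xus.
Qed.

Let B0 := take (Q * size Xr) [seq b <- B | spare b].

Let B0_size : size B0 = (Q * size Xr)%N.
Proof.
rewrite size_take size_filter; case: ltnP => // H.
by apply/eqP; rewrite eqn_leq H spare_many.
Qed.

Let B0_uniq : uniq B0. Proof. exact/take_uniq/filter_uniq. Qed.

Let B0P b : b \in B0 -> spare b /\ b \in B.
Proof. by move=> /mem_take; rewrite mem_filter => /andP[]. Qed.

Let B0_perm : perm_eq [seq b <- B | b \in B0] B0.
Proof.
apply: uniq_perm => //; first exact: filter_uniq.
by move=> b; rewrite mem_filter andb_idr// => /B0P[].
Qed.

(** Correct the path on [B0] by [correct_residues]; since all points of the cube in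
    [V r] are then taken, and these span a non-degenerate space, the new path is
    non-degenerate. *)
Lemma good_path_exists psi : path_supp Xs nu B psi ->
  exists psi', [/\ path_supp Xs nu B psi',
    forall b, ~~ ((b \in B0) && (b \in B)) -> psi' b = psi b & good_path psi'].
Proof.
move=> sp.
pose cs x := (\sum_(b <- B | (b \notin B0) && (psi b == x)) b)%N.
have [|phi [phiX phiS phiG]] := @correct_residues k Q G Q_gt0 G0 GD Xr B0 cs GQ B0_uniq B0_size.
  by apply/allP => b /B0P[/andP[]].
pose psi' b := if b \in B0 then phi b else psi b.
have spE : path_sum B psi' = \sum_(x <- Xr) (cs x)%:R *: x + path_sum B0 phi.
  rewrite /path_sum (bigID (fun b => b \in B0))/= addrC; congr (_ + _); last first.
    rewrite -big_filter (perm_big _ B0_perm)/= big_seq [RHS]big_seq.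
    by apply: eq_bigr => b bB0; rewrite /psi' bB0.
  under [RHS]eq_bigr => x _ do rewrite /cs natr_sum scaler_suml big_mkcondr/=.
  rewrite exchange_big/= big_seq_cond [RHS]big_seq_cond.
  apply: eq_bigr => b /andP[bB nB0]; rewrite /psi' (negbTE nB0).
  have [_ pV pc] := path_supp_V sp bB.
  have pX : psi b \in Xr by rewrite mem_filter pV/=; apply/mem_cube_seq.
  rewrite (bigD1_seq (psi b)) ?filter_uniq ?cube_seq_uniq//= eqxx.
  by rewrite big1 ?addr0// => x xp; rewrite eq_sym (negbTE xp).
have phi_supp b : b \in B0 -> phi b \in Xs /\ nu b (phi b) != 0.
  move=> bB0; have [/andP[br _] bB] := B0P bB0.
  have phiVc : phi b \in V r /\ cube (phi b).
    move: (phiX b bB0); rewrite inE => /orP[/eqP->|].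
      by split; [exact: mem0v|exact: cube0].
    by rewrite mem_filter => /andP[? /mem_cube_seq].
  split; first by apply/mem_cube_seq; case: phiVc.
  rewrite /nu; have [_ ->] := block_of_in at_lt ta_le rr br.
  by apply/mu_supp.
exists psi'; split.
- by move=> b bB; rewrite /psi'; case: ifP => bB0; [exact: phi_supp|exact: sp].
- by move=> b; rewrite /psi'; case: ifP => // /[dup] /B0P[_ ->].
- split; first by rewrite spE.
  move=> s u su; have [x xX xsu] := separating_point su.
  have [b bB0 bx] := phiS x xX; have [_ bB] := B0P bB0.
  by exists b => //; rewrite /psi' bB0 bx.
Qed.

Lemma class_count (tau : R) : 0 < tau ->
  m0 ^+ (Q * size Xr)
  <= (card_set (L [set` B]))%:R * tau
     + tau `^ (- q) * moment Xs nu q <[onev k]>%VS B 0.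
Proof.
move=> tau0; rewrite /card_set.
apply: le_trans (@good_mass_le_card R k Xs nu nu_ge0 nu_sum q q01 B _ good_path
    (fset_set (L [set` B])) tau B_uniq tau0 _); last first.
  move=> psi sp gp; rewrite in_fset_set ?inE; last exact: finite_Lset.
  exact: good_path_class.
have <- : count (mem B0) B = (Q * size Xr)%N.
  by rewrite -B0_size -size_filter; apply: perm_size.
apply: pathE_lower => //; last exact: good_path_exists.
move=> b x bB bB0 xX; have [/andP[br _] _] := B0P bB0.
by rewrite /nu; have [_ ->] := block_of_in at_lt ta_le rr br; exact: m0_le.
Qed.

End Elements.
End ClassCount.

(** * Elements in a progression, and the final estimate *)

(** The exponential moment of a sum of independent indicators. *)
Lemma sublistE_half_count (R : realType) (s : seq nat) (S : pred nat) :
  (forall b, b \in s -> (0 < b)%N) ->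
  sublistE s (fun B => 2^-1 ^+ count S B)
    <= expR (- (2^-1 * \sum_(b <- s | S b) b%:R^-1)) :> R.
Proof.
elim: s => [|b s IH] s0 /=; first by rewrite big_nil mulr0 oppr0 expR0 expr0.
have {}IH := IH (fun x xs => s0 x (mem_behead (s := b :: s) xs)).
have -> : (fun B => 2^-1 ^+ (S b + count S B)) = (fun B => 2^-1 ^+ S b * 2^-1 ^+ count S B) :> (_ -> R).
  by apply/funext => B; rewrite exprD.
rewrite sublistEZ.
set E := sublistE s _ in IH *.
have E0 : 0 <= E.
  rewrite -(sublistE_cst s 0); apply: sublistE_le => [x xs|B _].
    by apply: s0; rewrite inE xs orbT.
  by rewrite exprn_ge0// invr_ge0.
rewrite big_cons; case: (S b) => /=; last first.
  by rewrite expr0; apply: le_trans IH; rewrite le_eqVlt; apply/orP; left; apply/eqP; ring.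
rewrite mulrDr opprD expRD expr1.
have -> : (1 - b%:R^-1) * E + b%:R^-1 * (2^-1 * E) = (1 + - (2^-1 * b%:R^-1)) * E.
  by field; rewrite pnatr_eq0 -lt0n s0 ?mem_head.
have /andP[i0 i1] := @invn_itv R b (s0 b (mem_head _ _)).
by apply: ler_pM => //; [lra|exact: expR_ge1Dx].
Qed.

(** Restrict the sum to the elements [Q (a + j) + 1]: their inverses are at least
    [1 / (Q (a + j + 1))], which leaves a harmonic sum. *)
Lemma progression_sum (R : realType) (Q a t : nat) (X : seq nat) :
  (0 < Q)%N -> (0 < a)%N -> (0 < t)%N -> uniq X ->
  (forall b, (a < b <= t)%N -> (b == 1 %[mod Q])%N -> b \in X) ->
  Q%:R^-1 * (ln t%:R - ln a%:R - ln (2 * Q)%:R - 1)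
    <= \sum_(b <- X | (a < b <= t)%N && (b == 1 %[mod Q])%N) b%:R^-1 :> R.
Proof.
move=> Q0 a0 t0 uX XP; pose S b := (a < b <= t)%N && (b == 1 %[mod Q])%N.
pose l := (t %/ Q - a)%N.
pose Y := [seq (Q * (a + j) + 1)%N | j <- iota 0 l].
have uY : uniq Y.
  rewrite map_inj_in_uniq ?iota_uniq// => i j _ _ /addIn /eqP.
  by rewrite eqn_pmul2l// eqn_add2l => /eqP.
have YS b : b \in Y -> S b && (b \in X).
  move=> /mapP[j]; rewrite mem_iota /= add0n => jl ->.
  have jt : (a + j < t %/ Q)%N by move: jl; rewrite /l; clear; lia.
  have bt : (a < Q * (a + j) + 1 <= t)%N.
    apply/andP; split; first by rewrite addn1 ltnS (leq_trans (leq_addr j a))// leq_pmull.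
    apply: leq_trans (leq_trunc_div t Q); rewrite mulnC addn1.
    by rewrite ltn_pmul2r.
  have b1 : (Q * (a + j) + 1 == 1 %[mod Q])%N by rewrite mulnC modnMDl.
  by rewrite /S bt b1 XP.
apply: (@le_trans _ _ (\sum_(b <- Y) b%:R^-1)); last first.
  have pY : perm_eq Y [seq b <- X | b \in Y].
    apply: uniq_perm => //; first exact: filter_uniq.
    by move=> b; rewrite mem_filter andb_idr// => /YS/andP[].
  rewrite (perm_big _ pY)/=.
  rewrite big_filter [leLHS]big_mkcond [leRHS]big_mkcond/=.
  apply: ler_sum => b _; case: ifP => bY; first by have /andP[] := YS b bY; rewrite /S => ->.
  by case: ifP => // _; rewrite invr_ge0.
rewrite /Y big_map -[X in iota 0 X]subn0 big_mkord.
apply: (@le_trans _ _ (\sum_(j < l) Q%:R^-1 * (a + j).+1%:R^-1)); last first.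
  apply: ler_sum => j _; rewrite -invfM -natrM lef_pV2 ?posrE ?ltr0n ?ler_nat ?muln_gt0 ?Q0 ?addn1//.
  by rewrite mulnS addnC -[X in (X <= _)%N]add1n leq_add2r.
rewrite -mulr_sumr ler_wpM2l ?invr_ge0//.
apply: le_trans (@sum_inv_ge_ln R a l a0).
have al : (t <= 2 * Q * (a + l))%N.
  have H1 : (t %/ Q <= a + l)%N by rewrite /l; clear; lia.
  have H2 : (t < (t %/ Q).+1 * Q)%N by rewrite ltn_ceil.
  apply: ltnW; apply: leq_trans H2 _; rewrite mulnC -mulnA mulnCA leq_pmul2l//.
  by move: H1 a0; clear; lia.
have ln1 : ln t%:R - ln (2 * Q)%:R <= ln (a + l)%:R :> R.
  rewrite lerBlDr -lnM ?posrE ?ltr0n ?muln_gt0 ?addn_gt0 ?a0 ?Q0//.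
  by rewrite -natrM ler_ln ?posrE ?ltr0n ?ler_nat ?muln_gt0 ?addn_gt0 ?a0 ?Q0// mulnC.
have : a%:R^-1 <= 1 :> R by have /andP[] := @invn_itv R a a0.
lra.
Qed.

(** The level [tau] is chosen to be the inverse of the announced number, up to a
    constant, which makes [tau ^- q * N] at most half of the mass [m1]. *)
Lemma level_count (R : realType) (q m1 C delta Dx N card : R) :
  0 < q -> 0 < m1 -> 0 < C -> 0 < delta -> 0 < Dx -> 0 <= N ->
  N <= 2 / delta * C * Dx `^ (- q) ->
  (forall tau, 0 < tau -> m1 <= card * tau + tau `^ (- q) * N) ->
  m1 / 2 * (m1 / (4 * C)) `^ q^-1 * delta `^ q^-1 * Dx <= card.
Proof.
move=> q0 m10 C0 d0 Dx0 N0 HN H.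
move AE : (m1 / (4 * C)) => A.
have A0 : 0 < A by rewrite -AE divr_gt0// mulr_gt0.
pose T := A `^ q^-1 * delta `^ q^-1 * Dx.
have T0 : 0 < T by rewrite !mulr_gt0 ?powR_gt0.
have Tq : T `^ q = A * delta * Dx `^ q.
  rewrite /T !powRM ?mulr_ge0 ?powR_ge0 ?(ltW Dx0)// -!powRrM mulVf ?gt_eqF//.
  by rewrite !powRr1// ltW.
have Ti : T^-1 `^ (- q) = T `^ q.
  by rewrite -(powR_inv1 (ltW T0)) -powRrM mulN1r opprK.
have Ti0 : 0 < T^-1 by rewrite invr_gt0.
have := H _ Ti0; rewrite Ti => H1.
have H2 : T `^ q * N <= m1 / 2.
  apply: (@le_trans _ _ (T `^ q * (2 / delta * C * Dx `^ (- q)))).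
    by rewrite ler_wpM2l ?powR_ge0.
  rewrite Tq powRN -AE le_eqVlt; apply/orP; left; apply/eqP; field.
  by rewrite !gt_eqF ?powR_gt0.
have H3 : m1 / 2 <= card / T by lra.
have := ler_wpM2r (ltW T0) H3; rewrite divfK ?gt_eqF// => /(le_trans _); apply.
by rewrite /T !mulrA.
Qed.

(** Too few elements of [S] has probability at most [2 ^ N0] times the mean of
    [2 ^- count]; a value of [f] above [Nmax] is unlikely by Markov's inequality. *)
Lemma sublistE_two_failures (R : realType) (s : seq nat) (S : pred nat) (N0 : nat)
    (f : seq nat -> R) (Nmax del : R) (good : pred (seq nat)) :
  (forall b, b \in s -> (0 < b)%N) -> 0 < Nmax -> (forall B, 0 <= f B) ->
  (forall B, subseq B s -> (N0 <= count S B)%N -> f B <= Nmax -> good B) ->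
  2 ^+ N0 * sublistE s (fun B => 2^-1 ^+ count S B) <= del / 2 ->
  sublistE s f <= del / 2 * Nmax ->
  1 - del <= sublistE s (fun B => (good B)%:R).
Proof.
move=> s0 Nm0 f0 goodP few big.
have : sublistE s (fun=> 1) <= sublistE s (fun B => (good B)%:R +
    (2 ^+ N0 * 2^-1 ^+ count S B + Nmax^-1 * f B)).
  apply: sublistE_le => // B sB.
  have p0 : 0 <= 2 ^+ N0 * 2^-1 ^+ count S B :> R by rewrite mulr_ge0 ?exprn_ge0 ?invr_ge0.
  have r0 : 0 <= Nmax^-1 * f B by rewrite mulr_ge0 ?invr_ge0 ?(ltW Nm0).
  have [cS|cS] := leqP N0 (count S B); last first.
    have p1 : 1 <= 2 ^+ N0 * 2^-1 ^+ count S B :> R.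
      rewrite -(subnK (ltnW cS)) exprD -mulrA -exprMn divff ?pnatr_eq0// expr1n mulr1.
      by rewrite exprn_ege1// ler1n.
    by have := ler0n R (good B); lra.
  have [fN|fN] := leP (f B) Nmax; first by rewrite goodP//=; lra.
  have r1 : 1 <= Nmax^-1 * f B by rewrite ler_pdivlMl// mulr1 ltW.
  by have := ler0n R (good B); lra.
rewrite sublistE_cst !sublistED !sublistEZ.
have : Nmax^-1 * sublistE s f <= del / 2 by rewrite ler_pdivrMl// mulrC.
lra.
Qed.

Unset Implicit Arguments.

Theorem propositionA3 (R : realType) (k r : nat)
  (V : nat -> {vspace 'rV[rat]_k}) (c : nat -> R)
  (mu : nat -> 'rV[rat]_k -> R) (eps : R) (omega : nat -> 'rV[rat]_k)
  (hk : (2 <= k)%N)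
  (hsys : entropy_system r V c mu)
  (hc1 : c 1%N = 1)
  (hc_dec : forall j, (1 <= j <= r)%N -> c j.+1 < c j)
  (hc_pos : 0 < c r.+1)
  (hsupp : forall j, (1 <= j <= r)%N ->
     [set x | mu j x != 0] = [set x | x \in V j] `&` @cube k)
  (heps : 0 < eps)
  (he : forall V' : nat -> {vspace 'rV[rat]_k}, proper_subflag r V' V ->
     entropy_e r V c mu + eps <= entropy_e r V' c mu)
  (homega_cube : forall t, (1 <= t <= (\dim (V r)).-1)%N -> cube (omega t))
  (homega_basis : basis_of (V r) (one_omega omega (\dim (V r)).-1))
  (homega_span : forall j, (j <= r)%N ->
     V j = << one_omega omega (\dim (V j)).-1 >>%VS) :
  exists2 kappa0 : R,
    0 < kappa0 /\
    (forall j, (1 <= j <= r)%N -> 2 * kappa0 < c j - c j.+1) &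
    forall kappa : R, 0 < kappa <= kappa0 ->
    exists C0 alpha : R, [/\ 0 < C0, 0 < alpha &
      forall delta : R, 0 < delta < 1 ->
      exists D0 : R, forall D : R, D0 <= D ->
      forall i : nat, (1 <= i)%N ->
      forall (dT : measure_display) (T : measurableType dT)
        (P : probability T R) (A : T -> set nat),
        log_random_set P A ->
        ((1 - delta)%:E <=
          P [set w | (C0 * delta `^ alpha *
                D `^ ((1 - kappa / i%:R) *
                      \sum_(1 <= j < r.+1) c j * (dimq V j)%:R)
              <= (card_set (Lset r V c (Gamma omega (\dim (V r)).-1)
                              kappa D i (A w)))%:R)%R])%E].
Proof.
have r_gt0 : (0 < r)%N.
  rewrite lt0n; apply/eqP => r0.
  have k0 : (0 < k)%N by rewrite (leq_trans _ hk).
  have [x] := es_nondeg hsys (s := Ordinal k0) (t := Ordinal hk) isT.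
  by rewrite r0 (es_V0 hsys) => /vlineP[z ->]; rewrite !mxE.
have V_mono j : (j < r)%N -> (V j <= V j.+1)%VS by move=> /(es_V_lt hsys)[].
have V_sub j : (j <= r)%N -> (V j <= V r)%VS.
  move=> jr; have H n : (j + n <= r)%N -> (V j <= V (j + n)%N)%VS.
    elim: n => [|n IH]; first by rewrite addn0.
    rewrite addnS => jn; exact: subv_trans (IH (ltnW jn)) (V_mono _ jn).
  by have := H (r - j)%N; rewrite subnKC//; apply.
have mu_prob := es_mu hsys.
have rr : (1 <= r <= r)%N by rewrite r_gt0 leqnn.
have mu_suppE j x : (1 <= j <= r)%N -> mu j x != 0 <-> x \in V j /\ cube x.
  move=> jr; have := hsupp j jr => /seteqP[H1 H2].
  by split=> [/H1[]//|[xV xc]]; apply: H2.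
pose Xs := cube_seq k; pose Xr := [seq x <- Xs | x \in V r].
pose G := Gamma omega (\dim (V r)).-1.
have G0 : G 0 by exact: inIntSpan0.
have GD x y : G x -> G y -> G (x + y) by exact: inIntSpanD.
have [|Q Q0 GQ] := @common_multiple k G Xr G0 GD.
  move=> x; rewrite mem_filter => /andP[xV _].
  by apply: inIntSpan_den; rewrite -(homega_span _ (leqnn r)).
have [|m0 m0_itv m0_le] := @finite_pos_lower R _ [seq x <- Xs | mu r x != 0] (mu r).
  move=> x; rewrite mem_filter => /andP[nx _].
  by rewrite lt_def nx (mu_ge0 mu_prob).
have [kap0 [g0 [/andP[k0 k1] gg0 kgap ksmall gP]]] :=
  @kappa_choice R k r c mu eps hc1 hc_dec heps.
exists kap0 => // kap /andP[kp0 kpk].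
pose q := system_q r mu eps.
have q01 : 0 < q < 1 by exact: system_q_itv.
have /andP[q0 _] := q01.
pose C := scale_const r mu eps * expR (q * (r%:R * (k%:R + log_bound r mu) * ln 2)).
have C0 : 0 < C.
  by rewrite mulr_gt0 ?expR_gt0// (lt_le_trans ltr01)//; exact: scale_const_ge1.
pose N0 := (Q * size Xr)%N; pose m1 := m0 ^+ N0.
have /andP[m00 m01] := m0_itv.
have m10 : 0 < m1 by rewrite exprn_gt0.
have ln20 : 0 < ln 2 :> R by rewrite ln_gt0// ltr1n.
exists (m1 / 2 * (m1 / (4 * C)) `^ q^-1), q^-1; split.
- by rewrite mulr_gt0 ?powR_gt0 ?divr_gt0// mulr_gt0.
- by rewrite invr_gt0.
move=> delta /andP[d0 d1].
(* [n0] bounds from below the elements for which [M_block_bound] holds; [Y] is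
   the logarithmic length of the last block that makes the probability of
   having fewer than [N0] spare elements at most [delta / 2]. *)
pose n0 : R := 4 / (q * (eps / (4 * r%:R)) * ln 2).
pose Z : R := 2 ^+ N0 * (2 / delta).
have Z0 : 0 < Z by rewrite mulr_gt0 ?exprn_gt0 ?divr_gt0.
pose Y : R := ln 2 + ln (2 * Q)%:R + 1 + 2 * Q%:R * ln Z.
have [D1 D11 HD1] := powR_unbounded (expR Y) gg0.
have [D2 D21 HD2] := powR_unbounded (n0 + 1) hc_pos.
have [D3 D31 HD3] := powR_unbounded 2 gg0.
exists (Num.max D1 (Num.max D2 D3)) => D; rewrite !ge_max => /and3P[DD1 DD2 DD3].
move=> i i1 dT T P A HA.
have D_ge1 : 1 <= D := le_trans D11 DD1.
have D_gt0 : 0 < D := lt_le_trans ltr01 D_ge1.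
pose theta := kap / i%:R.
have i0 : 0 < i%:R :> R by rewrite ltr0n.
have th0 : 0 <= theta by rewrite divr_ge0 ?ltW.
have thk : theta <= kap0.
  by apply: le_trans kpk; rewrite ler_pdivrMr// ler_peMr ?ler1n// ltW.
have th_itv : 0 <= theta <= 2^-1 by rewrite th0 (le_trans thk).
have gap j : (1 <= j <= r)%N -> g0 <= c j * (1 - theta) - c j.+1.
  by apply: gP; rewrite th0.
pose a := lower_end c D; pose t := upper_end c D theta.
have D_gap j : (1 <= j <= r)%N -> 2 <= D `^ (c j * (1 - theta) - c j.+1).
  by move=> jr; apply: le_trans (HD3 D DD3) _; rewrite ler_powR// gap.
have a_big j : (1 <= j <= r)%N -> n0 <= (a j)%:R.
  by move=> jr; exact: (lower_scale_big hc1 hc_dec D_ge1 (HD2 D DD2) jr).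
have n0_gt0 : 0 < n0.
  have e0 : 0 < eps / (4 * r%:R) by rewrite divr_gt0// mulr_gt0// ltr0n.
  exact: divr_gt0 (ltr0n _ 4) (mulr_gt0 (mulr_gt0 q0 e0) ln20).
have a_gt0 j : (1 <= j <= r)%N -> (0 < a j)%N.
  by move=> jr; rewrite -(ltr0n R) (lt_le_trans n0_gt0)// a_big.
have at_le j : (1 <= j <= r)%N -> (2 * a j <= t j)%N by exact: scale_ratio.
have at_lt j : (1 <= j <= r)%N -> (a j < t j)%N.
  move=> jr; apply: leq_trans (at_le j jr).
  by rewrite mul2n -addnn -[X in (X < _)%N]addn0 ltn_add2l a_gt0.
have ta_le j : (1 <= j < r)%N -> (t j.+1 <= a j)%N.
  by move=> jr; exact: (scale_disjoint hc1 hc_dec hc_pos D_ge1 th_itv jr).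
have t_le1 j : (1 <= j <= r)%N -> (t j <= t 1%N)%N.
  case: j => [//|[//|j]] jr.
  have H : (t j.+2 <= a 1%N)%N.
    by apply: (block_sep at_lt ta_le) => //; case/andP: jr.
  by apply: leq_trans H _; apply/ltnW/at_lt; rewrite r_gt0.
pose nu b := mu (block_of r a t b); pose s := active (in_blocks r a t) (t 1%N).
have s_uniq : uniq s by exact: active_uniq.
have s_gt0 b : b \in s -> (0 < b)%N by exact: active_gt0.
have memsE b : in_blocks r a t b -> b \in s.
  move=> bI; rewrite active_mem bI andbT.
  have /in_blocksP[j jr /andP[ab bt]] := bI.
  by rewrite (leq_ltn_trans _ ab)//= (leq_trans bt)// t_le1.
pose X := (1 - theta) * \sum_(1 <= j < r.+1) c j * (dimq V j)%:R.
pose Dx := D `^ X; have Dx0 : 0 < Dx by exact: powR_gt0.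
pose bnd := m1 / 2 * (m1 / (4 * C)) `^ q^-1 * delta `^ q^-1 * Dx.
pose good (B : seq nat) := bnd <= (card_set (Lset r V c G kap D i [set` B]))%:R.
have -> : [set w | bnd <= (card_set (Lset r V c G kap D i (A w)))%:R]
    = [set w | good (members A s w)].
  apply/seteqP; split=> w; rewrite /good /=;
  rewrite (@Lset_ext R k r V c G kap D i (A w) [set` members A s w])//.
  - apply/seteqP; split=> b [Ab bI]; split=> //.
      by rewrite /= mem_filter asboolT//=; apply/memsE/IsetE.
    by move: Ab; rewrite /= mem_filter => /andP[/asboolP].
  - apply/seteqP; split=> b [Ab bI]; split=> //.
      by rewrite /= mem_filter asboolT//=; apply/memsE/IsetE.
    by move: Ab; rewrite /= mem_filter => /andP[/asboolP].
rewrite (prob_members HA)// lee_fin.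
(* spare elements are those used to correct the sums modulo [Gamma] *)
pose spare b := in_block a t b r && (b == 1 %[mod Q])%N.
pose Nmax := 2 / delta * C * Dx `^ (- q).
have Nmax0 : 0 < Nmax := mulr_gt0 (mulr_gt0 (divr_gt0 (ltr0n _ 2) d0) C0) (powR_gt0 _ Dx0).
apply: (@sublistE_two_failures R s spare N0
   (fun B => moment Xs nu q <[onev k]>%VS B 0) Nmax) => //.
- move=> B; apply: moment_ge0 => //.
    by move=> b x; apply: (mu_ge0 mu_prob); exact: block_ofP.
  by move=> b; apply: (mu_sum mu_prob); exact: block_ofP.
- move=> B sB cB fB; apply: (@level_count R q m1 C delta Dx _ _ q0 m10 C0 d0 Dx0 _ fB).
    apply: moment_ge0 => //.
      by move=> b x; apply: (mu_ge0 mu_prob); exact: block_ofP.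
    by move=> b; apply: (mu_sum mu_prob); exact: block_ofP.
  move=> tau tau0.
  apply: (@class_count R k r V c mu G kap D i B) => //.
  + exact: subseq_uniq sB s_uniq.
  + by move=> b /(mem_subseq sB); rewrite active_mem => /andP[].
  + by move=> j x; exact: (mu_ge0 mu_prob).
  + by move=> j; exact: (mu_sum mu_prob).
  + by have [xs [xsc VE]] := es_V_span hsys (leqnn r); exists xs.
  + exact: es_nondeg hsys.
  + by rewrite ltW.
  + by move=> x xX nx; apply: m0_le; rewrite mem_filter nx.
- have HS := progression_sum R (Q := Q) (a := a r) (t := t r) Q0 (a_gt0 r rr)
    (leq_ltn_trans (leq0n _) (at_lt r rr)) s_uniq _.
  apply: (@le_trans _ _ (2 ^+ N0 * expR (- (2^-1 * \sum_(b <- s | spare b) b%:R^-1)))).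
    by rewrite ler_wpM2l ?exprn_ge0// sublistE_half_count.
  have dZ : delta / 2 = 2 ^+ N0 * expR (- ln Z).
    rewrite expRN lnK ?posrE// /Z invfM invf_div mulrA divff ?mul1r//.
  rewrite dZ ler_wpM2l ?exprn_ge0// ler_expR lerN2.
  have lnD0 : 0 <= ln D by exact: ln_ge0.
  have YD : Y <= g0 * ln D.
    by rewrite -ler_expR (le_trans (HD1 D DD1))// /powR gt_eqF.
  have /andP[cr0 _] := c_bounds hc1 hc_dec (j := r.+1) (ltnSn _).
  have cr_pos : 0 <= c r.+1 by rewrite ltW.
  have ct_pos : 0 <= c r * (1 - theta) 
    by apply: le_trans cr_pos _; rewrite -subr_ge0 (le_trans (ltW gg0) (gap r rr)).
  have /andP[lt1 _] := ln_truncn_powR D_ge1 ct_pos.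
  have /andP[_ la2] := ln_truncn_powR D_ge1 cr_pos.
  have gD := ler_wpM2r lnD0 (gap r rr).
  rewrite -ler_pdivrMl ?invr_gt0// invrK; apply: le_trans (HS _); last first.
    by move=> b bt _; apply: memsE; apply/in_blocksP; exists r.
  rewrite ler_pdivlMl ?ltr0n//.
  move: YD lt1 la2 gD; rewrite /Y -/(upper_end c D theta r) -/(lower_end c D r) -/t -/a mulrBl.
  by clear; lra.
- have := mean_moment_bound r_gt0 (es_V0 hsys) V_mono mu_prob hc1 hc_dec hc_pos
    heps he D_ge1 th_itv _ (lexx n0) D_gap (HD2 D DD2).
  rewrite (es_V0 hsys) -/q -/C => /(_ _)/le_trans; apply.
    apply: le_trans ksmall; rewrite ler_wpM2r// mulr_ge0 ?ler0n//.
    exact: log_bound_ge0.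
  rewrite /Nmax /Dx -powRrM -/X le_eqVlt; apply/orP; left; apply/eqP.
  rewrite (_ : X * - q = - (q * X)); last by ring.
  by field; rewrite gt_eqF.
Qed.
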